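(* Suppose that $(A,\alpha,\mathcal{L})$ is a regular Exel system such that $\mathcal{L}$ is faithful on $\overline{A\alpha(A)A}$. Then $\alpha(A)=(\ker\mathcal{L}|_{MD(\mathcal{L})})^\perp$. Hence $\alpha$ is uniquely determined by $\mathcal{L}$ and $$A\times_{\alpha,\mathcal{L}}\mathbb{N}=C^*\big(A,\mathcal{L};\overline{A(\ker\mathcal{L}|_{MD(\mathcal{L})})^\perp A}\big).$$ In particular, if $\overline{A(\ker\mathcal{L}|_{MD(\mathcal{L})})^\perp A}=N_{\mathcal{L}}^\perp$, then $A\times_{\alpha,\mathcal{L}}\mathbb{N}=C^*(A,\mathcal{L})$.
   Context: Conventions: ideals are closed and two-sided; for an ideal $I$ in $A$, $I^\perp=\{a\in A:aI=\{0\}\}$; $\overline{XYZ}$ is the closed linear span of products. Exel systems. An Exel system $(A,\alpha,\mathcal{L})$ consists of a $C^*$-algebra $A$, an endomorphism $\alpha:A\to A$ and a positive linear map $\mathcal{L}:A\to A$ with $\mathcal{L}(a\alpha(b))=\mathcal{L}(a)b$ for all $a,b\in A$ (then $\mathcal{L}$ is automatically completely positive). It is regular if $\alpha\circ\mathcal{L}$ is a conditional expectation from $A$ onto $\alpha(A)$. $\mathcal{L}$ is faithful on a $C^*$-subalgebra $C$ if $a\in C$, $\mathcal{L}(a^*a)=0$ imply $a=0$. The multiplicative domain is $MD(\mathcal{L}):=\{a\in A:\mathcal{L}(b)\mathcal{L}(a)=\mathcal{L}(ba),\ \mathcal{L}(a)\mathcal{L}(b)=\mathcal{L}(ab)\ \forall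 b\in A\}$, a $C^*$-subalgebra on which $\mathcal{L}$ is multiplicative; $(\ker\mathcal{L}|_{MD(\mathcal{L})})^\perp$ denotes the annihilator, taken in $MD(\mathcal{L})$, of the ideal $\ker\mathcal{L}|_{MD(\mathcal{L})}$ of $MD(\mathcal{L})$. $N_{\mathcal{L}}:=\{a\in A:\mathcal{L}((ab)^*ab)=0\ \forall b\in A\}$. Exel's crossed product. A representation of $(A,\alpha,\mathcal{L})$ is a pair $(\pi,S)$, $\pi:A\to B(H)$ a non-degenerate representation, $S\in B(H)$, with $S\pi(a)=\pi(\alpha(a))S$, $S^*\pi(a)S=\pi(\mathcal{L}(a))$; a redundancy is a pair $(\pi(a),k)$, $a\in A$, $k\in\overline{\pi(A)SS^*\pi(A)}$, with $\pi(a)\pi(b)S=k\pi(b)S$ for all $b\in A$. $A\times_{\alpha,\mathcal{L}}\mathbb{N}$ is the quotient of the $C^*$-algebra generated by $i_A(A)\cup i_A(A)t$, for a universal representation $(i_A,t)$ of $(A,\alpha,\mathcal{L})$, by the ideal generated by $\{i_A(a)-k:a\in\overline{A\alpha(A)A},\ (i_A(a),k)\text{ a redundancy of }(i_A,t)\}$. Relative crossed products by $\mathcal{L}$. A representation of $(A,\mathcal{L})$ is a pair $(\pi,S)$ with $\pi:A\to B(H)$ non-degenerate and $S^*\pi(a)S=\pi(\mathcal{L}(a))$, $a\in A$; a redundancy is a pair $(\pi(a),k)$, $a\in A$, $k\in\overline{\pi(A)S\pi(A)S^*\pi(A)}$, with $\pi(a)\pi(b)S=k\pi(b)S$ for all $b\in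 A$. For an ideal $J$ in $A$, $C^*(A,\mathcal{L};J)$ is the quotient of the $C^*$-algebra generated by $i_A(A)\cup i_A(A)t$, for the universal representation $(i_A,t)$ of $(A,\mathcal{L})$, by the ideal generated by $\{i_A(a)-k:a\in J,\ (i_A(a),k)\text{ a redundancy of }(i_A,t)\}$; $C^*(A,\mathcal{L}):=C^*(A,\mathcal{L};N_{\mathcal{L}}^\perp)$. Equality of two such universal algebras means that the identity on the generators induces an isomorphism. *)

(* Defs.v *)
From HB Require Import structures.
From mathcomp Require Import all_boot all_order all_algebra complex.
From mathcomp Require Import boolp classical_sets functions reals topology normedtype.
From mathcomp Require Import ring lra.
Set Implicit Arguments. Unset Strict Implicit. Unset Printing Implicit Defensive.
Import Order.TTheory GRing.Theory Num.Theory numFieldNormedType.Exports.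
Local Open Scope classical_set_scope.
Local Open Scope complex_scope.
Local Open Scope ring_scope.

(* The inner product is linear in the first variable. *)
HB.mixin Record CompleteNormedModule_isHilbert (R : realType) H
    & CompleteNormedModule R[i] H := {
  inner : H -> H -> R[i];
  innerDZl : forall (c : R[i]) x y z,
    inner (c *: x + y) z = c * inner x z + inner y z;
  inner_conj : forall x y, inner y x = (inner x y)^*;
  inner_norm : forall x, `|x| ^+ 2 = inner x x
}.
#[short(type="hilbertType")]
HB.structure Definition Hilbert (R : realType) :=
  {H of CompleteNormedModule_isHilbert R H & CompleteNormedModule R[i] H}.

(* The norm is R[i]-valued; since |z| is a nonnegative real in R[i], the
   axioms below are the usual ones.  No unit is assumed. *)
HB.mixin Record CompleteNormedModule_isCStarAlgebra (R : realType) A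
    & CompleteNormedModule R[i] A := {
  cmul : A -> A -> A;
  adj : A -> A;
  cmulA : associative cmul;
  cmulDZl : forall (c : R[i]) x y z,
    cmul (c *: x + y) z = c *: cmul x z + cmul y z;
  cmulDZr : forall (c : R[i]) x y z,
    cmul z (c *: x + y) = c *: cmul z x + cmul z y;
  adjDZ : forall (c : R[i]) x y, adj (c *: x + y) = c^* *: adj x + adj y;
  adjM : forall x y, adj (cmul x y) = cmul (adj y) (adj x);
  adjK : involutive adj;
  norm_cmul : forall x y, `|cmul x y| <= `|x| * `|y|;
  norm_adjM : forall x, `|cmul (adj x) x| = `|x| ^+ 2
}.
#[short(type="cstarAlgType")]
HB.structure Definition CStarAlgebra (R : realType) :=
  {A of CompleteNormedModule_isCStarAlgebra R A & CompleteNormedModule R[i] A}.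

Notation "x ** y" := (cmul x y) (at level 40, left associativity) : ring_scope.

Section RealNorm.
Variables (R : realType) (V : normedZmodType R[i]).
Definition rnorm (x : V) : R := complex.Re `|x|.
Lemma rnormE x : `|x| = (rnorm x)%:C.
Proof. by rewrite RRe_real// normr_real. Qed.
Lemma rnorm_ge0 x : 0 <= rnorm x.
Proof. by rewrite -ler0c -rnormE. Qed.
Lemma rnorm_eq0 x : rnorm x = 0 -> x = 0.
Proof. by move=> h; apply/normr0_eq0; rewrite rnormE h. Qed.
Lemma rnormD x y : rnorm (x + y) <= rnorm x + rnorm y.
Proof. by rewrite -lecR rmorphD/= -!rnormE ler_normD. Qed.
End RealNorm.

Lemma Re_le_rnorm (R : realType) (z : R[i]) : complex.Re z <= rnorm z.
Proof.
by rewrite -lecR -rnormE (le_trans _ (normc_ge_Re z))// lecR ler_norm.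
Qed.

Lemma rnormZ (R : realType) (V : normedModType R[i]) (c : R[i]) (x : V) :
  rnorm (c *: x) = rnorm c * rnorm x.
Proof. by apply: (@complexI R); rewrite rmorphM/= -!rnormE normrZ. Qed.

Section InnerTheory.
Variables (R : realType) (H : hilbertType R).
Implicit Types (x y z : H) (c : R[i]).

Lemma inner0l z : inner 0 z = 0.
Proof.
by have := innerDZl 0 0 0 z; rewrite scale0r addr0 mul0r add0r; 
   have := innerDZl 1 0 0 z; rewrite scale1r addr0 mul1r => /eqP;
   rewrite -subr_eq0 opprD addrA subrr sub0r oppr_eq0 => /eqP.
Qed.
Lemma innerDl x y z : inner (x + y) z = inner x z + inner y z.
Proof. by rewrite -{1}[x]scale1r innerDZl mul1r. Qed.
Lemma innerZl c x z : inner (c *: x) z = c * inner x z.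
Proof. by rewrite -[_ *: _]addr0 innerDZl inner0l addr0. Qed.
Lemma innerNl x z : inner (- x) z = - inner x z.
Proof. by rewrite -scaleN1r innerZl mulN1r. Qed.
Lemma innerDr x y z : inner z (x + y) = inner z x + inner z y.
Proof. by rewrite inner_conj innerDl rmorphD/= -!inner_conj. Qed.
Lemma innerZr c x z : inner z (c *: x) = c^* * inner z x.
Proof. by rewrite inner_conj innerZl rmorphM/= -inner_conj. Qed.
Lemma innerNr x z : inner z (- x) = - inner z x.
Proof. by rewrite -scaleN1r innerZr rmorphN1 mulN1r. Qed.

Lemma Re_conj c : complex.Re c^* = complex.Re c.
Proof. by case: c. Qed.

Lemma rnorm_sqr x : rnorm x ^+ 2 = complex.Re (inner x x).
Proof. by rewrite -inner_norm rnormE -rmorphXn. Qed.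

Lemma rnorm_sqrD x y :
  rnorm (x + y) ^+ 2 =
  rnorm x ^+ 2 + 2 * complex.Re (inner x y) + rnorm y ^+ 2.
Proof.
rewrite !rnorm_sqr innerDl !innerDr !raddfD/= [inner y x]inner_conj Re_conj.
ring.
Qed.

Lemma inner_ext x y : (forall z, inner z x = inner z y) -> x = y.
Proof.
move=> h; apply/eqP; rewrite -subr_eq0 -normr_eq0 -sqrf_eq0 inner_norm.
by rewrite innerDr innerNr h subrr.
Qed.

Lemma Re_mulJ c : complex.Re (c * c^*) = rnorm c ^+ 2.
Proof. by rewrite -normCK rnormE -rmorphXn. Qed.

Lemma cauchy_schwarz x y : `|inner x y| <= `|x| * `|y|.
Proof.
rewrite !rnormE -rmorphM lecR.
have [y0|y0] := eqVneq (rnorm y) 0.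
  by rewrite (rnorm_eq0 y0) inner_conj inner0l rmorph0 /rnorm !normr0/= mulr0.
have ygt0 : 0 < rnorm y by rewrite lt_neqAle eq_sym y0 rnorm_ge0.
rewrite -(@ler_pXn2r _ 2) ?nnegrE ?mulr_ge0 ?rnorm_ge0//.
set w := inner x y.
have /(_ (- (w / (rnorm y ^+ 2)%:C))) := fun c => sqr_ge0 (rnorm (x + c *: y)).
rewrite rnorm_sqrD innerZr -/w rnormZ.
rewrite rmorphN rmorphM/= fmorphV/= mulNr raddfN/=.
set k := rnorm y in y0 ygt0 *.
rewrite -[w^* / _ * w]mulrAC [_ * w]mulrC.
have -> : (k ^+ 2)%:C^* = (k ^+ 2)%:C by exact: conjc_real.
rewrite -fmorphV/=.
have -> : complex.Re (w * w^* * (k ^- 2)%:C) = rnorm w ^+ 2 / k ^+ 2.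
  rewrite -Re_mulJ; case: (w * w^*) => a b /=.
  by rewrite mulr0 subr0.
have -> : rnorm (- (w * (k ^- 2)%:C)) = rnorm w / k ^+ 2.
  rewrite /rnorm normrN normrM.
  have -> : `|(k ^- 2)%:C| = (k ^- 2)%:C.
    by rewrite ger0_norm// ler0c invr_ge0 sqr_ge0.
  by rewrite rnormE -rmorphM.
have -> : (rnorm w / k ^+ 2 * k) ^+ 2 = rnorm w ^+ 2 / k ^+ 2.
  by field.
rewrite exprMn => h.
have {h} : 0 <= rnorm x ^+ 2 - rnorm w ^+ 2 / k ^+ 2.
  by apply: le_trans h _; lra.
by rewrite subr_ge0 ler_pdivrMr ?exprn_gt0.
Qed.

Lemma rcauchy_schwarz x y : rnorm (inner x y) <= rnorm x * rnorm y.
Proof. by rewrite -lecR rmorphM/= -!rnormE cauchy_schwarz. Qed.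

Section Riesz.
Variables (phi : H -> R[i]) (M : R).
Hypothesis phiDZ : forall c x y, phi (c *: x + y) = c * phi x + phi y.
Hypothesis phiM : forall x, `|phi x| <= M%:C * `|x|.

Let phiR x : rnorm (phi x) <= M * rnorm x.
Proof. by rewrite -lecR rmorphM/= -!rnormE. Qed.
Let J u := rnorm u ^+ 2 - 2 * complex.Re (phi u).
Let m := inf (range J).

Let Jlb u : - M ^+ 2 <= J u.
Proof.
have h1 := Re_le_rnorm (phi u); have h2 := phiR u.
have := sqr_ge0 (rnorm u - M); rewrite /J; nra.
Qed.

Let Jinf u : m <= J u.
Proof.
by apply: ge_inf; [exists (- M ^+ 2) => _ [v _ <-]; exact: Jlb | exists u].
Qed.

Let Jnear e : 0 < e -> exists u, J u < m + e.
Proof.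
move=> e0; have [|_ [u _ <-] h] := @inf_adherent R (range J) e e0.
  by split; [exists (J 0), 0 | exists (- M ^+ 2) => _ [v _ <-]; exact: Jlb].
by exists u.
Qed.

Let JD u v c : J (u + c *: v) = J u + 2 * complex.Re (c * (inner v u - phi v))
   + rnorm c ^+ 2 * rnorm v ^+ 2.
Proof.
rewrite /J rnorm_sqrD rnormZ [u + _]addrC phiDZ exprMn.
have -> : complex.Re (inner u (c *: v)) = complex.Re (c * inner v u).
  by rewrite [inner u _]inner_conj Re_conj innerZl.
rewrite mulrBr !raddfD/= raddfN/=.
ring.
Qed.

Let Jpar u v e : J u < m + e -> J v < m + e -> rnorm (u - v) ^+ 2 <= 4 * e.
Proof.
move=> hu hv.
have h := Jinf (2^-1%:C *: u + 2^-1%:C *: v).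
have phiZ c x : phi (c *: x) = c * phi x.
  have p0 : phi 0 = 0.
    by have := phiDZ (-1) 0 0; rewrite scaler0 addr0 mulN1r addNr.
  by rewrite -[_ *: _]addr0 phiDZ p0 addr0.
have half_norm : rnorm (2^-1%:C : R[i]) = 2^-1.
  by rewrite /rnorm ger0_norm// ler0c invr_ge0.
have := rnorm_sqrD u (- v); rewrite innerNr raddfN/=.
have -> : rnorm (- v) = rnorm v by rewrite /rnorm normrN.
move: h; rewrite /J (rnorm_sqrD (_ *: u)) phiDZ phiZ innerZl innerZr !rnormZ half_norm.
have ReZ (a : R) (z : R[i]) : complex.Re (a%:C * z) = a * complex.Re z.
  by case: z => p q /=; rewrite mul0r subr0.
have -> : (2^-1)%:C^* = (2^-1)%:C :> R[i] by exact: conjc_real.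
rewrite raddfD/= !ReZ.
move: hu hv; rewrite /J.
by nra.
Qed.

Lemma riesz : exists z, forall x, phi x = inner x z.
Proof.
pose S e := [set u | J u < m + e].
pose F := filter_from [set e : R | 0 < e] S.
have FF : ProperFilter F.
  apply: filter_from_proper.
    apply: filter_from_filter; first by exists 1 => /=.
    move=> e d e0 d0; exists (Num.min e d); first by rewrite /= lt_min e0 d0.
    move=> u; rewrite /S/= => h; split; apply: lt_le_trans h _;
      by rewrite lerD2l ge_min lexx ?orbT.
  by move=> e /Jnear[u hu]; exists u.
have Fcauchy : cauchy F.
  apply/cauchy_exP => e e0.
  have er : e = (complex.Re e)%:C by rewrite RRe_real// gtr0_real.
  have r0 : 0 < complex.Re e by rewrite -ltcR -er.
  have d0 : 0 < complex.Re e ^+ 2 / 8 by rewrite divr_gt0// exprn_gt0.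
  have [u hu] := Jnear d0.
  exists u; exists (complex.Re e ^+ 2 / 8) => // v hv.
  rewrite -ball_normE/= er rnormE ltcR.
  rewrite -(@ltr_pXn2r _ 2) ?nnegrE ?rnorm_ge0 ?(ltW r0)//.
  have := Jpar hu hv; nra.
have := cauchy_cvg F Fcauchy; set z := lim F => Fz.
exists z => x; apply/eqP; rewrite eq_sym -subr_eq0; apply/eqP/rnorm_eq0/eqP.
rewrite eq_le rnorm_ge0 andbT.
apply/ler_addgt0Pr => e e0; rewrite add0r.
set k := 1 + rnorm x ^+ 2.
have k0 : 0 < k by rewrite ltr_pwDl ?sqr_ge0.
pose d := (e / 2) ^+ 2 / k.
have d0 : 0 < d by rewrite divr_gt0// exprn_gt0// divr_gt0.
have l0 : 0 < 1 + rnorm x by rewrite ltr_pwDl ?rnorm_ge0.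
pose r := (e / 2) / (1 + rnorm x).
have r0 : 0 < r by rewrite !divr_gt0.
have FS : F (S d) by exists d.
have FB : F (ball z (r%:C)).
  by apply: Fz; apply: nbhsx_ballx; rewrite ltcR.
have [u [Su]] := filter_ex (filterI FS FB).
rewrite -ball_normE/= rnormE ltcR => zu.
set w := inner x u - phi x.
have hw : rnorm w <= e / 2.
  rewrite -(@ler_pXn2r _ 2) ?nnegrE ?rnorm_ge0 ?divr_ge0 ?(ltW e0)//.
  have kn0 : k != 0 by rewrite gt_eqF.
  have := Jinf (u + (- (k^-1%:C * w^*)) *: x).
  rewrite JD -/w mulNr raddfN/= -mulrA [_^* * w]mulrC.
  have -> : complex.Re (k^-1%:C * (w * w^*)) = rnorm w ^+ 2 / k.
    rewrite -Re_mulJ; case: (w * w^*) => p q /=.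
    by rewrite mul0r subr0 mulrC.
  have -> : rnorm (- (k^-1%:C * w^*)) = rnorm w / k.
    rewrite /rnorm normrN normrM norm_conjC.
    have -> : `|k^-1%:C : R[i]| = k^-1%:C.
      by rewrite ger0_norm// ler0c invr_ge0 ltW.
    by rewrite rnormE -rmorphM mulrC.
  move: Su; rewrite /S/= => Su hJ.
  have : rnorm w ^+ 2 / k <= d.
    have : (rnorm w / k) ^+ 2 * rnorm x ^+ 2 <= rnorm w ^+ 2 / k.
      have -> : (rnorm w / k) ^+ 2 * rnorm x ^+ 2
        = (rnorm w ^+ 2 / k) * (rnorm x ^+ 2 / k) by field.
      rewrite ler_piMr ?divr_ge0 ?sqr_ge0 ?(ltW k0)//.
      by rewrite ler_pdivrMr// mul1r /k lerDr.
    move: Su hJ; lra.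
  by rewrite /d ler_pdivrMr// mulrVK ?unitfE.
have -> : inner x z - phi x = inner x (z - u) + w.
  by rewrite /w innerDr innerNr addrA subrK.
apply: le_trans (rnormD _ _) _.
have := rcauchy_schwarz x (z - u).
have : rnorm x * rnorm (z - u) <= e / 2.
  have -> : e / 2 = (1 + rnorm x) * r by rewrite /r; field; rewrite gt_eqF.
  by apply: ler_pM; rewrite ?rnorm_ge0// ?lerDr// ltW.
move: hw; lra.
Qed.
End Riesz.
End InnerTheory.

Section BoundedOperators.
Variables (R : realType) (H : hilbertType R).

Definition bounded_linear (f : H -> H) :=
  linear f /\ exists M : R, forall x, `|f x| <= M%:C * `|x|.

(* Elements of B(H); the C*-structure is composition, the adjoint obtained from
   the Riesz representation theorem, and the operator norm. *)
Record bop := Bop { bop_fun :> H -> H; bop_bounded : bounded_linear bop_fun }.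
Implicit Types (f g h : bop) (c : R[i]) (x y : H).

Lemma bop_ext f g : f =1 g -> f = g.
Proof.
case: f g => [f fP] [g gP] /= /funext fg; subst g.
by congr Bop; exact: Prop_irrelevance.
Qed.

Lemma bopDZ f c x y : f (c *: x + y) = c *: f x + f y.
Proof. by have [fl _] := bop_bounded f; rewrite fl. Qed.
Lemma bopD f x y : f (x + y) = f x + f y.
Proof. by rewrite -{1}[x]scale1r bopDZ scale1r. Qed.
Lemma bop0 f : f 0 = 0.
Proof. by apply: (addrI (f 0)); rewrite -bopD !addr0. Qed.
Lemma bopZ f c x : f (c *: x) = c *: f x.
Proof. by rewrite -[_ *: _]addr0 bopDZ bop0 addr0. Qed.
Lemma bopN f x : f (- x) = - f x.
Proof. by rewrite -scaleN1r bopZ scaleN1r. Qed.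

Definition bop_norm f : R :=
  inf [set M : R | 0 <= M /\ forall x, `|f x| <= M%:C * `|x|].

Lemma bop_bounded0 f :
  [set M : R | 0 <= M /\ forall x, `|f x| <= M%:C * `|x|] !=set0.
Proof.
have [_ [M fM]] := bop_bounded f; exists `|M|; split=> [|x] /=; first exact: normr_ge0.
by rewrite (le_trans (fM x))// ler_wpM2r// lecR ler_norm.
Qed.

Lemma bop_norm_ge0 f : 0 <= bop_norm f.
Proof. by apply: lb_le_inf => [|M []]; first exact: bop_bounded0. Qed.

Lemma le_bop_norm f (M : R) :
  0 <= M -> (forall x, rnorm (f x) <= M * rnorm x) -> bop_norm f <= M.
Proof.
move=> M0 fM; apply: ge_inf; first by exists 0 => ? [].
by split=> // x; rewrite !rnormE -rmorphM lecR.
Qed.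

Lemma bop_normP f x : rnorm (f x) <= bop_norm f * rnorm x.
Proof.
have [x0|x0] := eqVneq (rnorm x) 0.
  by rewrite x0 (rnorm_eq0 x0) bop0 mulr0 /rnorm normr0.
have xgt0 : 0 < rnorm x by rewrite lt_neqAle eq_sym x0 rnorm_ge0.
rewrite -ler_pdivrMr//; apply: lb_le_inf; first exact: bop_bounded0.
by move=> M [_ /(_ x)]; rewrite !rnormE -rmorphM lecR ler_pdivrMr.
Qed.

Fact bounded_linear0 : bounded_linear (fun=> 0).
Proof.
split=> [c x y|]; first by rewrite scaler0 addr0.
by exists 0 => x; rewrite normr0 mul0r.
Qed.
Definition bop_zero := Bop bounded_linear0.

Fact bounded_linearD f g : bounded_linear (fun x => f x + g x).
Proof.
split=> [c x y|]; first by rewrite !bopDZ scalerDr addrACA.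
exists (bop_norm f + bop_norm g) => x.
rewrite !rnormE -rmorphM lecR (le_trans (rnormD _ _))// mulrDl.
by rewrite lerD ?bop_normP.
Qed.
Definition bop_add f g := Bop (bounded_linearD f g).

Fact bounded_linearZ c f : bounded_linear (fun x => c *: f x).
Proof.
split=> [d x y|].
  by rewrite bopDZ scalerDr !scalerA mulrC.
exists (rnorm c * bop_norm f) => x.
by rewrite !rnormE -rmorphM lecR rnormZ -mulrA ler_wpM2l ?rnorm_ge0 ?bop_normP.
Qed.
Definition bop_scale c f := Bop (bounded_linearZ c f).
Definition bop_opp f := bop_scale (-1) f.

Fact bounded_linearM f g : bounded_linear (f \o g).
Proof.
split=> [d x y|]; first by rewrite /= !bopDZ.
exists (bop_norm f * bop_norm g) => x.
rewrite !rnormE -rmorphM lecR -mulrA (le_trans (bop_normP _ _))//.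
by rewrite ler_wpM2l ?bop_norm_ge0 ?bop_normP.
Qed.
Definition bop_comp f g := Bop (bounded_linearM f g).

Lemma bop_adj_exists f y : exists z, forall x, inner (f x) y = inner x z.
Proof.
apply: (@riesz _ _ (fun x => inner (f x) y) (bop_norm f * rnorm y)).
  by move=> c u v; rewrite bopDZ innerDZl.
move=> x; rewrite !rnormE -rmorphM lecR (le_trans (rcauchy_schwarz _ _))//.
by rewrite mulrAC ler_wpM2r ?rnorm_ge0 ?bop_normP.
Qed.

Definition bop_adj_fun f y : H := sval (cid (bop_adj_exists f y)).
Lemma bop_adj_funP f x y : inner (f x) y = inner x (bop_adj_fun f y).
Proof. exact: (svalP (cid (bop_adj_exists f y))). Qed.

Lemma bop_adj_fun_le f y : rnorm (bop_adj_fun f y) <= bop_norm f * rnorm y.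
Proof.
set z := bop_adj_fun f y.
have [z0|z0] := eqVneq (rnorm z) 0.
  by rewrite z0 mulr_ge0 ?bop_norm_ge0 ?rnorm_ge0.
have zgt0 : 0 < rnorm z by rewrite lt_neqAle eq_sym z0 rnorm_ge0.
rewrite -(ler_pM2l zgt0) -expr2 rnorm_sqr -bop_adj_funP.
apply: le_trans (Re_le_rnorm _) _; apply: le_trans (rcauchy_schwarz _ _) _.
by rewrite mulrA ler_wpM2r ?rnorm_ge0// mulrC bop_normP.
Qed.

Fact bounded_linear_adj f : bounded_linear (bop_adj_fun f).
Proof.
split=> [c x y|].
  apply: inner_ext => z.
  by rewrite -bop_adj_funP !innerDr !innerZr -!bop_adj_funP.
exists (bop_norm f) => x.
by rewrite !rnormE -rmorphM lecR bop_adj_fun_le.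
Qed.
Definition bop_adj f := Bop (bounded_linear_adj f).

HB.instance Definition _ := gen_eqMixin bop.
HB.instance Definition _ := gen_choiceMixin bop.

Fact bop_addA : associative bop_add.
Proof. by move=> f g h; apply: bop_ext => x /=; rewrite addrA. Qed.
Fact bop_addC : commutative bop_add.
Proof. by move=> f g; apply: bop_ext => x /=; rewrite addrC. Qed.
Fact bop_add0 : left_id bop_zero bop_add.
Proof. by move=> f; apply: bop_ext => x /=; rewrite add0r. Qed.
Fact bop_addN : left_inverse bop_zero bop_opp bop_add.
Proof. by move=> f; apply: bop_ext => x /=; rewrite scaleN1r addNr. Qed.
HB.instance Definition _ :=
  GRing.isZmodule.Build bop bop_addA bop_addC bop_add0 bop_addN.

Fact bop_scaleA c d f : bop_scale c (bop_scale d f) = bop_scale (c * d) f.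
Proof. by apply: bop_ext => x /=; rewrite scalerA. Qed.
Fact bop_scale1 : left_id 1 bop_scale.
Proof. by move=> f; apply: bop_ext => x /=; rewrite scale1r. Qed.
Fact bop_scaleDr : right_distributive bop_scale +%R.
Proof. by move=> c f g; apply: bop_ext => x /=; rewrite scalerDr. Qed.
Fact bop_scaleDl f : {morph bop_scale^~ f : c d / c + d}.
Proof. by move=> c d; apply: bop_ext => x /=; rewrite scalerDl. Qed.
HB.instance Definition _ := GRing.Zmodule_isLmodule.Build R[i] bop
  bop_scaleA bop_scale1 bop_scaleDr bop_scaleDl.

Fact bop_normD f g : (bop_norm (f + g))%:C <= (bop_norm f)%:C + (bop_norm g)%:C.
Proof.
rewrite -rmorphD lecR; apply: le_bop_norm => [|x].
  by rewrite addr_ge0 ?bop_norm_ge0.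
by rewrite mulrDl (le_trans (rnormD _ _))// lerD ?bop_normP.
Qed.
Fact bop_normZ c f : (bop_norm (c *: f))%:C = `|c| * (bop_norm f)%:C.
Proof.
rewrite rnormE -rmorphM; congr (_%:C); apply/eqP; rewrite eq_le; apply/andP.
split.
  apply: le_bop_norm => [|x]; first by rewrite mulr_ge0 ?rnorm_ge0 ?bop_norm_ge0.
  by rewrite rnormZ -mulrA ler_wpM2l ?rnorm_ge0 ?bop_normP.
have [c0|c0] := eqVneq (rnorm c) 0; first by rewrite c0 mul0r bop_norm_ge0.
have cgt0 : 0 < rnorm c by rewrite lt_neqAle eq_sym c0 rnorm_ge0.
rewrite mulrC -ler_pdivlMr//; apply: le_bop_norm => [|x].
  by rewrite divr_ge0 ?bop_norm_ge0 ?rnorm_ge0.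
rewrite mulrAC ler_pdivlMr// mulrC -rnormZ.
exact: (bop_normP (c *: f)).
Qed.
Fact bop_norm_eq0 f : (bop_norm f)%:C = 0 -> f = 0.
Proof.
move=> /(@complexI R _ 0) f0; apply: bop_ext => x; apply: rnorm_eq0; apply/eqP.
by rewrite eq_le rnorm_ge0 andbT (le_trans (bop_normP _ _))// f0 mul0r.
Qed.
HB.instance Definition _ := Lmodule_isNormed.Build R[i] bop
  bop_normD bop_normZ bop_norm_eq0.

Lemma bop_subE f g x : (f - g) x = f x - g x.
Proof. by rewrite /= scaleN1r. Qed.

Lemma bop_normE f : rnorm f = bop_norm f. Proof. by []. Qed.

Fact bop_complete (F : set_system bop) : ProperFilter F -> cauchy F -> cvg F.
Proof.
move=> FF /cauchyP Fc.
have Fc' (e : R) : 0 < e -> exists f, F [set g | bop_norm (f - g) < e].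
  move=> e0; have /Fc[f Ff] : 0 < e%:C by rewrite ltcR.
  exists f; apply: filterS Ff => g.
  by rewrite -ball_normE/= rnormE ltcR.
pose Fx (x : H) := (fun f : bop => f x) @ F.
have Fx_cvg x : cvg (Fx x).
  apply: cauchy_cvg; apply/cauchy_exP => e e0.
  have er : e = (complex.Re e)%:C by rewrite RRe_real// gtr0_real.
  have r0 : 0 < complex.Re e by rewrite -ltcR -er.
  have l0 : 0 < 1 + rnorm x by rewrite ltr_pwDl ?rnorm_ge0.
  have [f Ff] := Fc' (complex.Re e / (1 + rnorm x)) (divr_gt0 r0 l0).
  exists (f x); change (F [set g : bop | ball (f x) e (g x)]).
  apply: filterS Ff => g /= fg.
  rewrite -ball_normE/= er rnormE ltcR -bop_subE.
  apply: le_lt_trans (bop_normP (f - g) x) _.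
  move: fg; rewrite ltr_pdivlMr// => fg; apply: le_lt_trans fg.
  by rewrite ler_wpM2l ?bop_norm_ge0// lerDr.
pose l x : H := lim (Fx x).
have near_l x (d : R) : 0 < d -> F [set g : bop | rnorm (l x - g x) < d].
  move=> d0; have : F [set g : bop | ball (l x) d%:C (g x)].
    by apply: (Fx_cvg x); apply: nbhsx_ballx; rewrite ltcR.
  by apply: filterS => g; rewrite -ball_normE/= rnormE ltcR.
have l_le (f : bop) (e : R) x : F [set g | bop_norm (f - g) < e] ->
    rnorm (l x - f x) <= e * rnorm x.
  move=> Ff; apply/ler_addgt0Pr => d d0.
  have [g [/= gl fg]] := filter_ex (filterI (near_l x _ d0) Ff).
  have -> : l x - f x = (l x - g x) + (g x - f x) by rewrite addrA subrK.
  apply: le_trans (rnormD _ _) _; rewrite addrC lerD ?(ltW gl)//.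
  have -> : rnorm (g x - f x) = rnorm ((f - g) x).
    by rewrite bop_subE /rnorm distrC.
  by rewrite (le_trans (bop_normP _ _))// ler_wpM2r ?rnorm_ge0 ?(ltW fg).
have l_lin : linear l.
  move=> c x y; apply/eqP; rewrite -subr_eq0; apply/eqP/rnorm_eq0/eqP.
  rewrite eq_le rnorm_ge0 andbT; apply/ler_addgt0Pr => e e0; rewrite add0r.
  have k0 : 0 < 2 + rnorm c by rewrite ltr_pwDl ?rnorm_ge0.
  have d0 : 0 < e / (2 + rnorm c) by rewrite divr_gt0.
  have [g [[/= g1 g2] g3]] := filter_ex (filterI (filterI
    (near_l (c *: x + y) _ d0) (near_l x _ d0)) (near_l y _ d0)).
  have -> : l (c *: x + y) - (c *: l x + l y) =
      (l (c *: x + y) - g (c *: x + y)) + (c *: (g x - l x) + (g y - l y)).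
    rewrite bopDZ scalerBr (addrACA (c *: g x)) -(opprD (c *: l x)).
    by rewrite addrA subrK.
  have rsub (a b : H) : rnorm (a - b) = rnorm (b - a) by rewrite /rnorm distrC.
  apply: le_trans (rnormD _ _) _.
  apply: (@le_trans _ _ (e / (2 + rnorm c) + (rnorm c * (e / (2 + rnorm c)) +
    e / (2 + rnorm c)))).
    rewrite lerD ?(ltW g1)// (le_trans (rnormD _ _))// lerD//.
      by rewrite rnormZ ler_wpM2l ?rnorm_ge0// rsub ltW.
    by rewrite rsub ltW.
  rewrite le_eqVlt; apply/orP; left; apply/eqP; field.
  by rewrite gt_eqF.
have l_bd : bounded_linear l.
  split=> //; have [f Ff] := Fc' 1 ltr01.
  exists (1 + bop_norm f) => x; rewrite !rnormE -rmorphM lecR.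
  rewrite -[l x](subrK (f x)) (le_trans (rnormD _ _))// mulrDl.
  by rewrite lerD ?bop_normP// l_le.
pose L := Bop l_bd; apply/cvg_ex; exists L.
apply/cvgrPdist_le => e e0.
have er : e = (complex.Re e)%:C by rewrite RRe_real// gtr0_real.
have r0 : 0 < complex.Re e / 2 by rewrite divr_gt0// -ltcR -er.
have [f Ff] := Fc' _ r0.
apply: filterS (Ff) => g /= fg; rewrite er rnormE lecR.
apply: le_bop_norm => [|x]; first by rewrite -(lecR 0) -er ltW.
have -> : (L - g) x = (l x - f x) + (f - g) x.
  by rewrite !bop_subE addrA subrK.
apply: le_trans (rnormD _ _) _.
have := l_le _ _ x Ff; have := bop_normP (f - g) x.
have := rnorm_ge0 x; nra.
Qed.
HB.instance Definition _ := Uniform_isComplete.Build bop bop_complete.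

Fact bop_compA : associative bop_comp.
Proof. by move=> f g h; apply: bop_ext. Qed.
Fact bop_compDZl c f g h :
  bop_comp (c *: f + g) h = c *: bop_comp f h + bop_comp g h.
Proof. exact: bop_ext. Qed.
Fact bop_compDZr c f g h :
  bop_comp h (c *: f + g) = c *: bop_comp h f + bop_comp h g.
Proof. by apply: bop_ext => x /=; rewrite bopDZ. Qed.
Fact bop_adjDZ c f g : bop_adj (c *: f + g) = c^* *: bop_adj f + bop_adj g.
Proof.
apply: bop_ext => y; apply: inner_ext => x /=.
by rewrite -bop_adj_funP /= innerDr innerZr conjCK -!bop_adj_funP innerDZl.
Qed.
Fact bop_adjM f g : bop_adj (bop_comp f g) = bop_comp (bop_adj g) (bop_adj f).
Proof.
apply: bop_ext => y; apply: inner_ext => x /=.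
by rewrite -bop_adj_funP /= -!bop_adj_funP.
Qed.
Fact bop_adjK : involutive bop_adj.
Proof.
move=> f; apply: bop_ext => y; apply: inner_ext => x /=.
by rewrite -bop_adj_funP /= [LHS]inner_conj -bop_adj_funP -inner_conj.
Qed.
Fact bop_norm_comp f g : `|bop_comp f g| <= `|f| * `|g|.
Proof.
rewrite !rnormE -rmorphM lecR !bop_normE.
apply: le_bop_norm => [|x]; first by rewrite mulr_ge0 ?bop_norm_ge0.
rewrite -mulrA (le_trans (bop_normP f (g x)))//.
by rewrite ler_wpM2l ?bop_norm_ge0 ?bop_normP.
Qed.
Lemma bop_norm_adj f : bop_norm (bop_adj f) <= bop_norm f.
Proof.
by apply: le_bop_norm => [|x]; [exact: bop_norm_ge0 | exact: bop_adj_fun_le].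
Qed.
Fact bop_norm_adjM f : `|bop_comp (bop_adj f) f| = `|f| ^+ 2.
Proof.
apply/eqP; rewrite eq_le; apply/andP; split.
  rewrite (le_trans (bop_norm_comp _ _))// expr2 ler_wpM2r//.
  by rewrite !rnormE lecR bop_norm_adj.
rewrite !rnormE -rmorphXn lecR !bop_normE.
set n := bop_norm (bop_comp _ _).
have n0 : 0 <= n by exact: bop_norm_ge0.
rewrite -[leRHS]sqr_sqrtr// ler_pXn2r ?nnegrE ?bop_norm_ge0 ?sqrtr_ge0//.
apply: le_bop_norm => [|x]; first exact: sqrtr_ge0.
rewrite -(@ler_pXn2r _ 2) ?nnegrE ?mulr_ge0 ?rnorm_ge0 ?sqrtr_ge0//.
rewrite exprMn sqr_sqrtr// rnorm_sqr bop_adj_funP.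
apply: le_trans (Re_le_rnorm _) _; apply: le_trans (rcauchy_schwarz _ _) _.
rewrite expr2 [leRHS]mulrA mulrC ler_wpM2r ?rnorm_ge0//.
exact: (bop_normP (bop_comp (bop_adj f) f)).
Qed.
HB.instance Definition _ := CompleteNormedModule_isCStarAlgebra.Build R bop
  bop_compA bop_compDZl bop_compDZr bop_adjDZ bop_adjM bop_adjK
  bop_norm_comp bop_norm_adjM.

Lemma bop_adjP (f : bop) x y : inner (f x) y = inner x (adj f y).
Proof. exact: bop_adj_funP. Qed.

End BoundedOperators.

Section ClosedSpan.
Variables (R : realType) (V : normedModType R[i]).

Definition subspace (M : set V) :=
  M 0 /\ forall (c : R[i]) x y, M x -> M y -> M (c *: x + y).

Definition closed_span (X : set V) : set V :=
  smallest (fun M => subspace M /\ closed M) X.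

End ClosedSpan.

Section CStarNotions.
Variables (R : realType) (A : cstarAlgType R).

Definition span3 (X Y Z : set A) : set A :=
  closed_span [set w | exists x y z,
    [/\ X x, Y y, Z z & w = x ** y ** z]].

Definition cstar_subalgebra (B : set A) :=
  [/\ subspace B, closed B, forall x y, B x -> B y -> B (x ** y)
    & forall x, B x -> B (adj x)].

Definition cstar_generated (X : set A) : set A := smallest cstar_subalgebra X.

Definition closed_ideal (T I : set A) :=
  [/\ I `<=` T, subspace I, closed I
    & forall a x, T a -> I x -> I (a ** x) /\ I (x ** a)].

(* The ideal of the C*-subalgebra T generated by X; meant for X `<=` T. *)
Definition ideal_generated (T X : set A) : set A :=
  smallest (closed_ideal T) X.

Definition annihilator (T I : set A) : set A :=
  [set a | T a /\ forall x, I x -> a ** x = 0].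

Definition positive (a : A) := exists b, a = adj b ** b.

End CStarNotions.

(* *-homomorphisms defined on a C*-subalgebra T of A; the values of f outside T
   are irrelevant. *)
Definition star_hom_on (R : realType) (A B : cstarAlgType R) (T : set A)
    (f : A -> B) :=
  [/\ forall (c : R[i]) x y, T x -> T y -> f (c *: x + y) = c *: f x + f y,
      forall x y, T x -> T y -> f (x ** y) = f x ** f y
    & forall x, T x -> f (adj x) = adj (f x)].

Definition star_hom (R : realType) (A B : cstarAlgType R) (f : A -> B) :=
  star_hom_on setT f.

(* q exhibits B as the quotient of T by its ideal I. *)
Definition quotient_map (R : realType) (A B : cstarAlgType R) (T I : set A)
    (q : A -> B) :=
  [/\ star_hom_on T q, q @` T = setT
    & forall x, T x -> (q x = 0 <-> I x)].

Section ExelSystems.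
Variables (R : realType) (A : cstarAlgType R).
Implicit Types (alpha L : A -> A).

Definition positive_linear L :=
  linear L /\ forall a, positive a -> positive (L a).

Definition exel_system alpha L :=
  [/\ star_hom alpha, positive_linear L
    & forall a b, L (a ** alpha b) = L a ** b].

(* E is regarded as a map into A whose range is B. *)
Definition conditional_expectation (B : set A) (E : A -> A) :=
  [/\ positive_linear E, forall a, `|E a| <= `|a|, forall a, B (E a),
      forall b, B b -> E b = b
    & forall b a c, B b -> B c -> E (b ** a ** c) = b ** E a ** c].

Definition regular_exel_system alpha L :=
  exel_system alpha L /\ conditional_expectation (range alpha) (alpha \o L).

Definition faithful_on L (C : set A) :=
  forall a, C a -> L (adj a ** a) = 0 -> a = 0.

Definition MD L : set A :=
  [set a | forall b, L b ** L a = L (b ** a) /\ L a ** L b = L (a ** b)].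

Definition ker_MD L : set A := [set a | MD L a /\ L a = 0].

Definition NL L : set A :=
  [set a | forall b, L (adj (a ** b) ** (a ** b)) = 0].

End ExelSystems.

Section CrossedProducts.
Variables (R : realType) (A : cstarAlgType R).
Implicit Types (alpha L : A -> A) (J : set A) (H K : hilbertType R).

Definition nondegenerate_rep H (pi : A -> bop H) :=
  star_hom pi /\ closed_span [set y | exists a x, y = pi a x] = setT.

Definition exel_rep alpha L H (pi : A -> bop H) (S : bop H) :=
  [/\ nondegenerate_rep pi, forall a, S ** pi a = pi (alpha a) ** S
    & forall a, adj S ** pi a ** S = pi (L a)].

Definition L_rep L H (pi : A -> bop H) (S : bop H) :=
  nondegenerate_rep pi /\ forall a, adj S ** pi a ** S = pi (L a).

Definition exel_redundancy H (pi : A -> bop H) (S : bop H) (a : A)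
    (k : bop H) :=
  span3 (range pi) [set S ** adj S] (range pi) k /\
  forall b, pi a ** pi b ** S = k ** pi b ** S.

Definition L_redundancy H (pi : A -> bop H) (S : bop H) (a : A) (k : bop H) :=
  span3 (range pi) [set w | exists b, w = S ** pi b ** adj S] (range pi) k /\
  forall b, pi a ** pi b ** S = k ** pi b ** S.

Definition rep_algebra H (pi : A -> bop H) (S : bop H) : set (bop H) :=
  cstar_generated (range pi `|` [set w | exists a, w = pi a ** S]).

(* (iA, t) is universal for the class [rep] of representations: every member of
   the class is the image of (iA, t) under a *-homomorphism of the C*-algebra
   generated by iA(A) and iA(A)t. *)
Definition universal_rep (rep : forall H, (A -> bop H) -> bop H -> Prop)
    H (iA : A -> bop H) (t : bop H) :=
  rep H iA t /\
  forall K (pi : A -> bop K) (S : bop K), rep K pi S ->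
  exists f : bop H -> bop K, [/\ star_hom_on (rep_algebra iA t) f,
    forall a, f (iA a) = pi a & forall a, f (iA a ** t) = pi a ** S].

(* The universal algebras below are determined up to isomorphism, so they are
   described by predicates on triples (B, i, u), where B is a C*-algebra and
   i a, u a are the images in B of the generators iA a, iA a ** t. *)
Definition crossed_product_of
    (rep : forall H, (A -> bop H) -> bop H -> Prop)
    (redundancy : forall H, (A -> bop H) -> bop H -> A -> bop H -> Prop)
    J (B : cstarAlgType R) (i u : A -> B) :=
  exists H (iA : A -> bop H) (t : bop H) (q : bop H -> B),
  [/\ universal_rep rep iA t,
      quotient_map (rep_algebra iA t)
        (ideal_generated (rep_algebra iA t)
          [set w | exists a k,
            [/\ J a, redundancy H iA t a k & w = iA a - k]]) q,
      forall a, i a = q (iA a)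
    & forall a, u a = q (iA a ** t)].

Definition exel_crossed_product alpha L :=
  crossed_product_of (exel_rep alpha L) exel_redundancy
    (span3 setT (range alpha) setT).

Definition relative_crossed_product L J :=
  crossed_product_of (L_rep L) L_redundancy J.

Definition crossed_product_by L :=
  relative_crossed_product L (annihilator setT (NL L)).

(* Equality of universal algebras: the identity on the generators induces an
   isomorphism. *)
Definition same_universal_algebra
    (P Q : forall B : cstarAlgType R, (A -> B) -> (A -> B) -> Prop) :=
  forall (B C : cstarAlgType R) (i u : A -> B) (j v : A -> C),
  P B i u -> Q C j v ->
  exists Phi : B -> C, [/\ star_hom Phi, bijective Phi,
    forall a, Phi (i a) = j a & forall a, Phi (u a) = v a].

End CrossedProducts.

(* Main.v *)
Require Import Defs.
From mathcomp Require Import all_boot all_order all_algebra complex.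
From mathcomp Require Import boolp classical_sets functions reals topology normedtype.
From mathcomp Require Import lra.
Import Defs.
Import Order.TTheory GRing.Theory Num.Theory numFieldNormedType.Exports.
Local Open Scope classical_set_scope.
Local Open Scope complex_scope.
Local Open Scope ring_scope.
Set Implicit Arguments. Unset Strict Implicit. Unset Printing Implicit Defensive.

(** Write [E = alpha \o L].  Multiplying by [alpha c] on the right and
    polarizing, one gets that [E], then [L], is *-preserving, so that [L] is a
    bimodule map for [alpha] and [alpha(A)] lies in [MD L].  If [m] is in
    [ker_MD L] then [L] kills [(alpha(b) m)^* alpha(b) m], so faithfulness puts
    [alpha(A)] in the annihilator; conversely [d = a - alpha (L a)] is in
    [ker_MD L] for every [a] in [MD L], and [d d^* = 0] if [a] annihilates the
    kernel.

    For the crossed products, every representation [(pi, S)] of [(A, L)] satisfies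
    [S pi(a) = pi(alpha a) S], because the difference [D] of the two sides
    satisfies [S^* pi(c) D = 0].  The two notions of redundancy agree as well:
    the closed span [K] of [pi(A) S S^* pi(A)] and its subspace [K'] spanned by
    [pi(A) S pi(A) S^* pi(A)] satisfy [K K] in [K'], and an operator [k] is a
    limit of combinations of the operators [k (k^* k)^n] with [n >= 1].  So both
    crossed products are quotients of the same algebra by the same ideal, and it
    remains to compare two universal representations.  This only requires
    *-homomorphisms to be continuous: if [h] is self-adjoint and small, there is a
    self-adjoint [r] commuting with [h] such that [h + i (1 - r)] is unitary, and
    this is preserved by *-homomorphisms. *)

(** * Closed sets, subspaces and closed spans through the real-valued norm *)

Lemma rnorm_le_eps_eq0 (R : realType) (V : normedZmodType R[i]) (x : V) (C : R) :
  (forall e : R, 0 < e -> rnorm x <= C * e) -> x = 0.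
Proof.
move=> h; apply/rnorm_eq0/eqP; rewrite eq_le rnorm_ge0 andbT.
have k0 : 0 < 1 + `|C| by rewrite ltr_pwDl.
apply/ler_addgt0Pr => e e0; rewrite add0r.
apply: le_trans (h _ (divr_gt0 e0 k0)) _.
rewrite mulrA ler_pdivrMr// mulrC ler_pM2l// (le_trans (ler_norm C))//.
by rewrite lerDr.
Qed.

Section RealNormTopology.
Variables (R : realType) (V : normedModType R[i]).
Implicit Types (x y z : V) (M : set V).

Lemma rnorm0 : rnorm (0 : V) = 0.
Proof. by rewrite /rnorm normr0. Qed.

Lemma rnormN x : rnorm (- x) = rnorm x.
Proof. by rewrite /rnorm normrN. Qed.

Lemma rdistC x y : rnorm (x - y) = rnorm (y - x).
Proof. by rewrite -rnormN opprB. Qed.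

Lemma rnorm_real (c : R) : 0 <= c -> rnorm (c%:C : R[i]) = c.
Proof. by move=> c0; rewrite /rnorm ger0_norm// ler0c. Qed.

Lemma closed_rnormP M : closed M <->
  forall x, (forall e : R, 0 < e -> exists y, M y /\ rnorm (x - y) < e) -> M x.
Proof.
split=> [Mc x h|h].
  apply: Mc => B /nbhs_ballP[e /= e0 xB].
  have er : e = (complex.Re e)%:C by rewrite RRe_real// gtr0_real.
  have /h[y [My xy]] : 0 < complex.Re e by rewrite -ltcR -er.
  by exists y; split=> //; apply: xB; rewrite -ball_normE/= er rnormE ltcR.
move=> x clx; apply: h => e e0.
have /clx[y [My]] : nbhs x (ball x e%:C) by apply: nbhsx_ballx; rewrite ltcR.
by rewrite -ball_normE/= rnormE ltcR; exists y.
Qed.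

Lemma closed_zero : closed ([set 0] : set V).
Proof.
apply/closed_rnormP => x h; apply: (@rnorm_le_eps_eq0 _ _ _ 1) => e /h[y [/= ->]].
by rewrite subr0 mul1r => /ltW.
Qed.

Lemma subspace_zero : subspace ([set 0] : set V).
Proof. by split=> // c u v /= -> ->; rewrite addr0 scaler0. Qed.

Lemma subspaceD M : subspace M -> forall x y, M x -> M y -> M (x + y).
Proof. by move=> [_ Ml] x y Mx My; rewrite -[x]scale1r; apply: Ml. Qed.
Lemma subspaceZ M : subspace M -> forall c x, M x -> M (c *: x).
Proof. by move=> [M0 Ml] c x Mx; rewrite -[_ *: _]addr0; apply: Ml. Qed.
Lemma subspaceN M : subspace M -> forall x, M x -> M (- x).
Proof. by move=> Ms x Mx; rewrite -scaleN1r; exact: subspaceZ. Qed.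
Lemma subspaceB M : subspace M -> forall x y, M x -> M y -> M (x - y).
Proof. by move=> Ms x y Mx My; apply: subspaceD => //; exact: subspaceN. Qed.

Lemma subset_closed_span (X : set V) : X `<=` closed_span X.
Proof. by move=> x Xx M [_]; exact. Qed.

Lemma closed_span_min (X M : set V) :
  subspace M -> closed M -> X `<=` M -> closed_span X `<=` M.
Proof. by move=> ? ? XM x; apply. Qed.

Lemma subspace_closed_span (X : set V) : subspace (closed_span X).
Proof.
split=> [M [[[]]]//|c x y Mx My M MX].
by have [[Ms _] _] := MX; apply: Ms.2; [exact: Mx | exact: My].
Qed.

Lemma closed_closed_span (X : set V) : closed (closed_span X).
Proof.
apply/closed_rnormP => x h M MX; apply: (closed_rnormP M).1 MX.1.2 _ _ => e.
by move=> /h[y [Xy xy]]; exists y; split=> //; exact: Xy.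
Qed.
End RealNormTopology.

(** * Algebra and norm in a possibly non-unital C*-algebra *)

Section CStarTheory.
Variables (R : realType) (A : cstarAlgType R).
Implicit Types (x y z : A) (c : R[i]).

Lemma cmulDl x y z : (x + y) ** z = x ** z + y ** z.
Proof. by rewrite -{1}[x]scale1r cmulDZl scale1r. Qed.
Lemma cmulDr x y z : z ** (x + y) = z ** x + z ** y.
Proof. by rewrite -{1}[x]scale1r cmulDZr scale1r. Qed.
Lemma cmul0l x : 0 ** x = 0.
Proof. by apply: (addrI (0 ** x)); rewrite -cmulDl !addr0. Qed.
Lemma cmul0r x : x ** 0 = 0.
Proof. by apply: (addrI (x ** 0)); rewrite -cmulDr !addr0. Qed.
Lemma cmulZl c x y : (c *: x) ** y = c *: (x ** y).
Proof. by rewrite -[c *: x]addr0 cmulDZl cmul0l addr0. Qed.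
Lemma cmulZr c x y : x ** (c *: y) = c *: (x ** y).
Proof. by rewrite -[c *: y]addr0 cmulDZr cmul0r addr0. Qed.
Lemma cmulNl x y : (- x) ** y = - (x ** y).
Proof. by rewrite -scaleN1r cmulZl scaleN1r. Qed.
Lemma cmulNr x y : x ** (- y) = - (x ** y).
Proof. by rewrite -scaleN1r cmulZr scaleN1r. Qed.
Lemma cmulBl x y z : (x - y) ** z = x ** z - y ** z.
Proof. by rewrite cmulDl cmulNl. Qed.
Lemma cmulBr x y z : z ** (x - y) = z ** x - z ** y.
Proof. by rewrite cmulDr cmulNr. Qed.
Lemma adjD x y : adj (x + y) = adj x + adj y.
Proof. by rewrite -{1}[x]scale1r adjDZ rmorph1 scale1r. Qed.
Lemma adj0 : adj (0 : A) = 0.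
Proof. by apply: (addrI (adj 0)); rewrite -adjD !addr0. Qed.
Lemma adjZ c x : adj (c *: x) = c^* *: adj x.
Proof. by rewrite -[c *: x]addr0 adjDZ adj0 addr0. Qed.
Lemma adjN x : adj (- x) = - adj x.
Proof. by apply/eqP; rewrite -addr_eq0 -adjD addNr adj0. Qed.
Lemma adjB x y : adj (x - y) = adj x - adj y.
Proof. by rewrite adjD adjN. Qed.

Lemma rnorm_cmul x y : rnorm (x ** y) <= rnorm x * rnorm y.
Proof. by rewrite -lecR rmorphM/= -!rnormE norm_cmul. Qed.
Lemma rnorm_adjM x : rnorm (adj x ** x) = rnorm x ^+ 2.
Proof. by apply: (@complexI R); rewrite rmorphXn/= -!rnormE norm_adjM. Qed.

Lemma adjM_eq0 x : adj x ** x = 0 -> x = 0.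
Proof.
move=> h; apply/rnorm_eq0/eqP; rewrite -sqrf_eq0 -rnorm_adjM h.
by rewrite /rnorm normr0.
Qed.
Lemma Madj_eq0 x : x ** adj x = 0 -> x = 0.
Proof. by move=> h; rewrite -[x]adjK (@adjM_eq0 (adj x)) ?adj0// adjK. Qed.
(** The self-adjoint element x^* x has square x^* (x x^* x) = 0; the C*-identity is applied
    twice. *)
Lemma MadjM_eq0 x : x ** adj x ** x = 0 -> x = 0.
Proof.
move=> h; apply/adjM_eq0/adjM_eq0.
by rewrite adjM adjK -!cmulA [x ** _]cmulA h cmul0r.
Qed.

Lemma rnorm_adj x : rnorm (adj x) = rnorm x.
Proof.
suff le y : rnorm y <= rnorm (adj y).
  by apply/eqP; rewrite eq_le le -{1}[x]adjK andbT (le_trans (le _))// !adjK.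
have [->|y0] := eqVneq (rnorm y) 0; first exact: rnorm_ge0.
have ygt0 : 0 < rnorm y by rewrite lt_neqAle eq_sym y0 rnorm_ge0.
by rewrite -(ler_pM2r ygt0) -expr2 -rnorm_adjM rnorm_cmul.
Qed.
End CStarTheory.

(** * Regular Exel systems and the range of [alpha] *)

Section RegularExelSystem.
Variables (R : realType) (A : cstarAlgType R) (alpha L : A -> A).
Hypothesis hreg : regular_exel_system alpha L.
Implicit Types a b x y : A.

Let alphaM a b : alpha (a ** b) = alpha a ** alpha b.
Proof. by have [[[_ h _] _ _] _] := hreg; exact: h. Qed.
Let alphaJ a : alpha (adj a) = adj (alpha a).
Proof. by have [[[_ _ h] _ _] _] := hreg; exact: h. Qed.
Let alphaDZ c a b : alpha (c *: a + b) = c *: alpha a + alpha b.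
Proof. by have [[[h _ _] _ _] _] := hreg; exact: h. Qed.
Let alpha0 : alpha 0 = 0.
Proof.
by have := alphaDZ (-1) 0 0; rewrite scaler0 add0r scaleN1r addNr.
Qed.
Let alphaB a b : alpha (a - b) = alpha a - alpha b.
Proof. by rewrite addrC -scaleN1r alphaDZ scaleN1r addrC. Qed.

Let LDZ c a b : L (c *: a + b) = c *: L a + L b.
Proof. by have [[_ [h _] _] _] := hreg; rewrite h. Qed.
Let L0 : L 0 = 0.
Proof. by have := LDZ (-1) 0 0; rewrite scaler0 add0r scaleN1r addNr. Qed.
Let LB a b : L (a - b) = L a - L b.
Proof. by rewrite addrC -scaleN1r LDZ scaleN1r addrC. Qed.
Let L_alpha a b : L (a ** alpha b) = L a ** b.
Proof. by have [[_ _ h] _] := hreg. Qed.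

Let E_alpha b : alpha (L (alpha b)) = alpha b.
Proof. by have [_ [_ _ _ h _]] := hreg; apply: h; exists b. Qed.
Let E_bimod a b c :
  alpha (L (alpha b ** a ** alpha c)) = alpha b ** alpha (L a) ** alpha c.
Proof.
have [_ [_ _ _ _ h]] := hreg.
by apply: (h (alpha b) a (alpha c)); [exists b | exists c].
Qed.

(* The elements [x + c y], [c = 1, i], suffice for the polarization. *)
Lemma positive_linear_polar (phi : A -> A) x y : positive_linear phi ->
  adj (phi (adj x ** y)) = phi (adj y ** x).
Proof.
move=> [phiDZ phi_ge0].
have phiD u v : phi (u + v) = phi u + phi v.
  by rewrite -{1}[u]scale1r phiDZ scale1r.
have phi0 : phi 0 = 0 by apply: (addrI (phi 0)); rewrite -phiD !addr0.
have phiZ c u : phi (c *: u) = c *: phi u.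
  by rewrite -[_ *: _]addr0 phiDZ phi0 addr0.
have phi_sa u : adj (phi (adj u ** u)) = phi (adj u ** u).
  have [|v ->] := phi_ge0 (adj u ** u); first by exists u.
  by rewrite adjM adjK.
set P := phi (adj x ** y); set Q := phi (adj y ** x).
have polar c : c^* *: adj P + c *: adj Q = c *: P + c^* *: Q.
  have := phi_sa (x + c *: y).
  rewrite adjD adjZ cmulDl !cmulDr !cmulZl !cmulZr !phiD !phiZ -/P -/Q.
  rewrite !adjD !adjZ !phi_sa conjCK !scalerA mulrC !addrA => /addIr.
  by rewrite -!addrA => /addrI.
have h1 : adj P + adj Q = P + Q by have := polar 1; rewrite rmorph1 !scale1r.
have hi : adj Q - adj P = P - Q.
  have := polar 'i; rewrite conjCi !scaleNr addrC -!scalerBr.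
  by apply: scalerI; exact: neq0Ci.
apply: (@scalerI _ _ 2 _) => //; first by rewrite pnatr_eq0.
rewrite !scaler_nat !mulr2n.
have := congr2 (fun u v => u - v) h1 hi.
by rewrite /= !opprB addrACA subrr addr0 [Q - P]addrC addrACA subrr add0r.
Qed.

(** The choice c = [adj b] gives x x^* = 0. This cancellation replaces the use of a unit. *)
Let E_sq_cancel x b : (forall c, x ** alpha c = 0) -> x = alpha b -> x = 0.
Proof. by move=> h xb; apply: Madj_eq0; rewrite {2}xb -alphaJ h. Qed.

(** The bimodule axiom has factors on both sides; the right one is introduced as [alpha c] and then
    cancelled. *)
Let E_left a b : alpha (L (alpha b ** a)) = alpha b ** alpha (L a).
Proof.
apply/eqP; rewrite -subr_eq0 -alphaM -alphaB; apply/eqP.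
apply: E_sq_cancel erefl => c.
by rewrite alphaB cmulBl -alphaM -L_alpha E_bimod !alphaM subrr.
Qed.

(** By polarization of E at [alpha c] and a, both sides agree after right multiplication by any
    [alpha c]. *)
Let E_adj a : alpha (L (adj a)) = adj (alpha (L a)).
Proof.
have [_ [Epos _ _ _ _]] := hreg.
apply/eqP; rewrite -subr_eq0 -alphaJ -alphaB; apply/eqP.
apply: E_sq_cancel erefl => c.
have /= := positive_linear_polar (alpha c) a Epos.
rewrite -[adj (alpha c)]alphaJ E_left L_alpha alphaM adjM.
rewrite -[adj (alpha (adj c))]alphaJ adjK => h.
by rewrite alphaB cmulBl alphaJ h subrr.
Qed.

(** Serves to lift to A identities that are known only after applying [alpha]. *)
Let L_ker a z : alpha z = 0 -> L a ** z = 0.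
Proof. by move=> z0; rewrite -L_alpha z0 cmul0r L0. Qed.

(** The difference z = [adj p - q] and its adjoint lie in the kernel of [alpha]. So [L_ker] gives p
    z = 0 and z q^* = 0, and z z^* z = z (p - q^* ) z vanishes. *)
Lemma regular_L_adj a : L (adj a) = adj (L a).
Proof.
set p := L a; set q := L (adj a).
have z0 : alpha (adj p - q) = 0 by rewrite alphaB alphaJ /p /q E_adj subrr.
have z'0 : alpha (adj q - p) = 0.
  by rewrite alphaB alphaJ /p /q E_adj adjK subrr.
set z := adj p - q in z0.
have pz : p ** z = 0 by exact: L_ker.
have zqJ : z ** adj q = 0.
  have qz' : q ** (adj q - p) = 0 by exact: L_ker.
  by rewrite -[z]adjK -adjM /z adjB adjK -opprB cmulNr qz' oppr0 adj0.
apply/eqP; rewrite eq_sym -subr_eq0; apply/eqP/MadjM_eq0.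
rewrite -/z {2}/z adjB adjK cmulBr zqJ subr0.
by rewrite -cmulA pz cmul0r.
Qed.

Let L_alphal a b : L (alpha b ** a) = b ** L a.
Proof.
rewrite -[alpha b ** a]adjK adjM -alphaJ regular_L_adj L_alpha.
by rewrite regular_L_adj adjM !adjK.
Qed.

(** The defect [b - L (alpha b)] lies in the kernel of [alpha], so [L a] kills it by [L_ker]; the
    other side follows by adjoints. *)
Let MD_alpha b : MD L (alpha b).
Proof.
have EE c : alpha (c - L (alpha c)) = 0 by rewrite alphaB E_alpha subrr.
move=> a; split; rewrite ?L_alpha ?L_alphal.
  by rewrite -[in RHS](subrK (L (alpha b)) b) cmulDr (L_ker a (EE b)) add0r.
apply/eqP; rewrite -subr_eq0 -cmulBl; apply/eqP.
rewrite -[X in X ** _]adjK -[L a]adjK -adjM -regular_L_adj.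
rewrite L_ker ?adj0// alphaJ -[_ - b]opprB -scaleN1r -[-1 *: _]addr0 alphaDZ.
by rewrite EE alpha0 addr0 scaler0 adj0.
Qed.

(** Since E is idempotent, z = [L (alpha (L a) - a)] and z^* lie in the kernel of [alpha]; as z is a
    value of L, [L_ker] yields z z^* = 0. *)
Let L_E a : L (alpha (L a)) = L a.
Proof.
have z0 : alpha (L (alpha (L a) - a)) = 0 by rewrite LB alphaB E_alpha subrr.
apply/eqP; rewrite -subr_eq0 -LB; apply/eqP/Madj_eq0.
by rewrite -regular_L_adj L_ker// regular_L_adj alphaJ z0 adj0.
Qed.

(** Equal ranges give [alpha' b - alpha b = alpha e], and both module rules give
    [L (x ** alpha e) = 0] for all x. Since E fixes alpha(e^* e), that element is 0. *)
Lemma regular_alpha_uniq alpha' : regular_exel_system alpha' L ->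
  range alpha' = range alpha -> alpha' = alpha.
Proof.
move=> [[_ _ L_alpha'] _] rr; apply/funext => b.
have [e' _ e'E] : range alpha (alpha' b) by rewrite -rr; exists b.
pose e := e' - b.
have eE : alpha' b - alpha b = alpha e by rewrite -e'E alphaB.
have Le x : L (x ** alpha e) = 0.
  by rewrite -eE cmulBr LB L_alpha L_alpha' subrr.
apply/eqP; rewrite -subr_eq0 eE; apply/eqP/adjM_eq0.
by rewrite -alphaJ -alphaM -E_alpha alphaM alphaJ Le alpha0.
Qed.

Hypothesis hfaithful : faithful_on L (span3 setT (range alpha) setT).

Let alpha_ker_MD b m : ker_MD L m -> alpha b ** m = 0.
Proof.
(* [w] itself lies in [A alpha(A) A] only up to an approximate unit. *)
move=> [mMD Lm0]; set w := alpha b ** m.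
have LM0 x : L (x ** m) = 0 by rewrite -(mMD x).1 Lm0 cmul0r.
apply: MadjM_eq0; apply: hfaithful.
  apply: subset_closed_span; exists (w ** adj m), (alpha (adj b ** b)), m.
  split=> //.
  by rewrite alphaM alphaJ [in LHS]/w adjM -!cmulA.
have -> : w ** adj w ** w = w ** adj w ** alpha b ** m by rewrite -[RHS]cmulA.
by rewrite cmulA LM0.
Qed.

Let L_MD_adj a : MD L a -> MD L (adj a).
Proof.
move=> aMD b; have [h1 h2] := aMD (adj b).
by split; apply: (can_inj (@adjK _ A)); rewrite adjM -!regular_L_adj adjM adjK.
Qed.

Lemma regular_range : range alpha = annihilator (MD L) (ker_MD L).
Proof.
apply/seteqP; split=> [_ [b _ <-]|a [aMD aker]].
  by split=> // m; exact: alpha_ker_MD.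
exists (L a) => //; set d := a - alpha (L a).
have dMD : MD L d.
  move=> b; rewrite cmulBr cmulBl !LB cmulBr cmulBl.
  have [-> ->] := aMD b.
  by have [-> ->] := MD_alpha (L a) b.
(* The adjoint is taken because a and [alpha (L a)] annihilate [ker_MD L] from the left: both kill
   d^*, so d d^* = 0. *)
have dker : ker_MD L (adj d).
  by split; [exact: L_MD_adj | rewrite regular_L_adj LB L_E subrr adj0].
apply/eqP; rewrite eq_sym -subr_eq0; apply/eqP/Madj_eq0; rewrite -/d.
by rewrite {1}/d cmulBl aker// alpha_ker_MD// subrr.
Qed.
End RegularExelSystem.

(** * Preimages under bounded maps that are linear on a subspace *)

Section BoundedPreimage.
Variables (R : realType) (V W : normedModType R[i]).
Variables (T : set V) (f : V -> W) (C : R) (M : set W).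
Hypothesis f_lin : forall c x y, T x -> T y -> f (c *: x + y) = c *: f x + f y.
Hypothesis f_bd : forall x, T x -> rnorm (f x) <= C * rnorm x.

(** With [closed_preimage], this carries a property [M (f x)] from generators to closed spans,
    subalgebras and ideals. *)
Lemma subspace_preimage :
  subspace T -> subspace M -> subspace [set x | T x /\ M (f x)].
Proof.
move=> Ts Ms; split.
  split; first exact: Ts.1.
  have := f_lin (-1) Ts.1 Ts.1.
  by rewrite scaler0 add0r scaleN1r addNr => ->; exact: Ms.1.
move=> c x y [Tx Mx] [Ty My]; split; first exact: Ts.2.
by rewrite f_lin//; exact: Ms.2.
Qed.

Lemma closed_preimage :
  subspace T -> closed T -> closed M -> closed [set x | T x /\ M (f x)].
Proof.
move=> Ts Tc Mc; apply/closed_rnormP => x h.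
have Tx : T x.
  by apply: (closed_rnormP T).1 Tc _ _ => e /h[y [[Ty _] xy]]; exists y.
split=> //; apply: (closed_rnormP M).1 Mc _ _ => e e0.
have k0 : 0 < 1 + `|C| by rewrite ltr_pwDl.
have [y [[Ty My] xy]] := h _ (divr_gt0 e0 k0).
exists (f y); split=> //.
have -> : f x - f y = f (x - y).
  by rewrite addrC -scaleN1r -f_lin// scaleN1r addrC.
apply: le_lt_trans (f_bd (subspaceB Ts Tx Ty)) _.
move: xy; rewrite ltr_pdivlMr// mulrC => xy; apply: le_lt_trans xy.
by rewrite ler_wpM2r ?rnorm_ge0// (le_trans (ler_norm C))// lerDr.
Qed.
End BoundedPreimage.

(** * Operators on a Hilbert space *)

Section OperatorLemmas.
Variables (R : realType) (H : hilbertType R).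
Implicit Types (k : bop H) (x : H).

(** The square expands to |x|^2 - 2 t |k x|^2 + t^2 |k^* k x|^2, and t |k|^2 <= 1 bounds the last
    term by t |k x|^2. *)
Lemma bop_descent k (t : R) x : 0 <= t -> t * rnorm k ^+ 2 <= 1 ->
  rnorm (x - t%:C *: adj k (k x)) ^+ 2 <= rnorm x ^+ 2 - t * rnorm (k x) ^+ 2.
Proof.
move=> t0 tk; rewrite rnorm_sqrD rnormN rnormZ rnorm_real//.
rewrite innerNr innerZr -bop_adjP raddfN/=.
have -> : t%:C^* = t%:C :> R[i] by exact: conjc_real.
have -> : complex.Re (t%:C * inner (k x) (k x)) = t * rnorm (k x) ^+ 2.
  by rewrite rnorm_sqr; case: (inner _ _) => p q /=; rewrite mul0r subr0.
have h : rnorm (adj k (k x)) <= rnorm k * rnorm (k x).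
  by rewrite -(rnorm_adj k); exact: bop_normP.
have h2 : rnorm (adj k (k x)) ^+ 2 <= rnorm k ^+ 2 * rnorm (k x) ^+ 2.
  by rewrite -exprMn ler_pXn2r ?nnegrE ?mulr_ge0 ?rnorm_ge0.
have h3 : t * rnorm (adj k (k x)) ^+ 2 <= rnorm (k x) ^+ 2.
  apply: le_trans (ler_wpM2l t0 h2) _.
  by rewrite mulrA ler_piMl// sqr_ge0.
rewrite exprMn expr2 -mulrA; have := ler_wpM2l t0 h3; lra.
Qed.

(* [k (1 - t k^* k)^n] tends to 0: it is [O(1 / sqrt n)] by [bop_descent]. *)
Lemma bop_mem_closed k (M : set (bop H)) : subspace M -> closed M ->
  M (k ** adj k ** k) -> (forall y, M y -> M (k ** adj k ** y)) -> M k.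
Proof.
move=> Ms Mc Mk kM.
have d0 : 0 < 1 + rnorm k ^+ 2 by rewrite ltr_pwDl ?sqr_ge0.
pose t := (1 + rnorm k ^+ 2)^-1.
have t0 : 0 < t by rewrite invr_gt0.
have tk : t * rnorm k ^+ 2 <= 1 by rewrite mulrC ler_pdivrMr// mul1r lerDr.
have tkJ : t * rnorm (adj k) ^+ 2 <= 1 by rewrite rnorm_adj.
pose y n : bop H := iter n (fun y => y - t%:C *: (k ** adj k ** y)) k.
(* By induction: k k^* y_n = k k^* k - k k^* (k - y_n), and both terms lie in M. *)
have My n : M (k - y n).
  elim: n => [|n IH]; first by rewrite subrr; exact: Ms.1.
  rewrite [y _]/= -/(y n) opprB addrCA [_ + (k - _)]addrC.
  apply: subspaceD => //; apply: subspaceZ => //.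
  have -> : y n = k - (k - y n) by rewrite opprB addrCA subrr addr0.
  by rewrite cmulBr; apply: subspaceB => //; exact: kM.
pose z n x : H := iter n (fun z => z - t%:C *: adj k (k z)) x.
have yz n x : y n x = k (z n x).
  elim: n => [//|n IH]; rewrite [y _]/= -/(y n) bop_subE /=.
  by rewrite IH [z _ _]/= -/(z n x) bopD bopN bopZ.
(* The descent of |z_n x|^2 at each step is at least t |y_n x|^2. As |y_n x| is nonincreasing, by
   [bop_descent] for k^*, the first n descents add up to at least t n |y_n x|^2. *)
have bound n x :
    t * n%:R * rnorm (y n x) ^+ 2 <= rnorm x ^+ 2 - rnorm (z n x) ^+ 2.
  elim: n => [|n IH]; first by rewrite mulr0 mul0r subrr.
  have h1 := bop_descent (z n x) (ltW t0) tk.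
  have h2 : rnorm (y n.+1 x) ^+ 2 <= rnorm (y n x) ^+ 2.
    have := bop_descent (y n x) (ltW t0) tkJ; rewrite adjK.
    rewrite [y n.+1]/= -/(y n) bop_subE /= => h.
    by apply: le_trans h _; rewrite gerBl mulr_ge0 ?sqr_ge0 ?(ltW t0).
  rewrite -[z n.+1 x]/(z n x - t%:C *: adj k (k (z n x))).
  rewrite -yz in h1 *; move: h1 IH.
  have := ler_wpM2l (mulr_ge0 (ltW t0) (ler0n R n)) h2.
  have := ler_wpM2l (ltW t0) h2.
  by rewrite -natr1 mulrDr mulr1 mulrDl; lra.
apply: (closed_rnormP M).1 Mc _ _ => e e0.
have c0 : 0 < t * (e / 2) ^+ 2 by rewrite mulr_gt0// exprn_gt0// divr_gt0.
pose n := Num.bound (t * (e / 2) ^+ 2)^-1.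
have nP : 1 <= t * n%:R * (e / 2) ^+ 2.
  have := @archi_boundP R (t * (e / 2) ^+ 2)^-1.
  rewrite invr_ge0 (ltW c0) => /(_ isT); rewrite -/n => /ltW.
  by rewrite -[_^-1]mul1r ler_pdivrMr// mulrA [n%:R * t]mulrC.
exists (k - y n); split=> //; rewrite opprB addrCA subrr addr0.
apply: (@le_lt_trans _ _ (e / 2)); last by rewrite ltr_pdivrMr// ltr_pMr// ltr1n.
apply: le_bop_norm => [|x]; first by rewrite divr_ge0// ltW.
rewrite -(@ler_pXn2r _ 2) ?nnegrE ?mulr_ge0 ?invr_ge0 ?rnorm_ge0 ?(ltW e0)//.
rewrite exprMn.
have h := bound n x; have hz := sqr_ge0 (rnorm (z n x)).
have s0 : 0 <= (e / 2) ^+ 2 by rewrite sqr_ge0.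
have y0 := sqr_ge0 (rnorm (y n x)).
have := ler_wpM2l s0 h; have := ler_wpM2r y0 nP.
have := mulr_ge0 s0 hz.
move: (rnorm (y n x) ^+ 2) (rnorm (z n x) ^+ 2) (rnorm x ^+ 2) ((e / 2) ^+ 2) => a b c d.
move: (t * n%:R) => m.
nra.
Qed.

(** Moving [pi a] to the other side of the inner product shows that every [pi a v] is orthogonal to
    D x; by nondegeneracy D x is orthogonal to itself. *)
Lemma nondegenerate_eq0 (A : cstarAlgType R) (pi : A -> bop H) (D : bop H) :
  nondegenerate_rep pi -> (forall c, pi c ** D = 0) -> D = 0.
Proof.
move=> [[_ _ piJ] nd] h; apply: bop_ext => x; set w := D x.
have sub : closed_span [set y | exists a x, y = pi a x] `<=`
    [set y | inner y w = 0].
  apply: closed_span_min.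
  + split=> /= [|c u v u0 v0]; first exact: inner0l.
    by rewrite innerDZl u0 v0 mulr0 addr0.
  + apply/closed_rnormP => u hu /=; apply: (@rnorm_le_eps_eq0 R _ _ (rnorm w)).
    move=> e /hu[v [/= v0 uv]].
    rewrite -[u](subrK v) innerDl v0 addr0 mulrC.
    apply: le_trans (rcauchy_schwarz _ _) _.
    by rewrite ler_wpM2r ?rnorm_ge0// ltW.
  + move=> _ [a [v ->]] /=.
    have /(congr1 (fun f : bop H => f x)) /= hx := h (adj a).
    by rewrite bop_adjP -piJ// /w hx inner_conj inner0l rmorph0.
have ww : inner w w = 0 by apply: sub; have : [set: H] w by []; rewrite -nd.
by apply/rnorm_eq0/eqP; rewrite -sqrf_eq0 rnorm_sqr ww.
Qed.
End OperatorLemmas.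

(** * Representations of [(A, L)] and their redundancies *)

Section LRepresentations.
Variables (R : realType) (A : cstarAlgType R) (alpha L : A -> A).
Hypothesis hexel : exel_system alpha L.
Variables (H : hilbertType R) (pi : A -> bop H) (S : bop H).
Hypothesis hrep : L_rep L pi S.

Let piM a b : pi (a ** b) = pi a ** pi b.
Proof. by have [[[_ h _] _] _] := hrep; exact: h. Qed.
Let piJ a : pi (adj a) = adj (pi a).
Proof. by have [[[_ _ h] _] _] := hrep; exact: h. Qed.
Let SpiS a : adj S ** pi a ** S = pi (L a).
Proof. by have [_ h] := hrep. Qed.

(* With [D = S pi(a) - pi(alpha a) S], the rule [L (x ** alpha y) = L x ** y]
   gives [S^* pi(c) D = 0] for all [c], whence [(pi(c) D)^* pi(c) D = 0]. *)
Lemma L_rep_exel_rep : exel_rep alpha L pi S.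
Proof.
have [nd _] := hrep.
have [_ _ L_alpha] := hexel.
split=> // a; apply/eqP; rewrite -subr_eq0; apply/eqP.
set D := S ** pi a - pi (alpha a) ** S.
have SD c : adj S ** pi c ** D = 0.
  rewrite cmulBr !cmulA SpiS -[_ ** pi c ** pi _]cmulA -!piM SpiS L_alpha.
  by rewrite subrr.
have DS c : adj D ** pi c ** S = 0.
  apply: (can_inj (@adjK _ (bop H))); rewrite adj0.
  by rewrite !adjM adjK -piJ cmulA SD.
apply: (nondegenerate_eq0 nd) => c; apply: adjM_eq0.
rewrite adjM -piJ -cmulA [pi _ ** (_ ** _)]cmulA -piM cmulA {2}/D cmulBr.
by rewrite !cmulA DS -[_ ** pi _ ** pi _]cmulA -piM DS cmul0l subrr.
Qed.

Let X : set (bop H) := [set w | exists b, w = S ** pi b ** adj S].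

(** A generator k = pi(c) S S^* pi(d) lacks a middle factor from pi(A), but k k^* acquires pi(L(d
    d^* )) there, so [bop_mem_closed] applies. Conversely, S pi(b) S^* = pi(alpha b) S S^*. *)
Lemma L_rep_span3 :
  span3 (range pi) [set S ** adj S] (range pi) = span3 (range pi) X (range pi).
Proof.
have [_ Spi _] := L_rep_exel_rep.
have gen c b d :
    span3 (range pi) X (range pi) (pi c ** (S ** pi b ** adj S) ** pi d).
  apply: subset_closed_span; exists (pi c), (S ** pi b ** adj S), (pi d).
  by split=> //; exists b.
have Ks Y : subspace (span3 (range pi) Y (range pi)) by exact: subspace_closed_span.
have Kc Y : closed (span3 (range pi) Y (range pi)) by exact: closed_closed_span.
apply/seteqP; split; apply: closed_span_min => //
    _ [_ [w [_ [[c _ <-] wX [d _ <-] ->]]]].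
  rewrite {w}wX; set k := _ ** _ ** _.
  have kJ : k ** adj k =
      pi c ** (S ** pi (L (d ** adj d)) ** adj S) ** pi (adj c).
    by rewrite /k !adjM adjK -!piJ -SpiS piM !cmulA.
  apply: (@bop_mem_closed _ _ k (span3 (range pi) X (range pi))).
  - exact: Ks.
  - exact: Kc.
  - rewrite kJ /k.
    have := gen c (L (d ** adj d) ** L (adj c ** c)) d.
    by rewrite !piM -[pi (L (adj c ** c))]SpiS piM !cmulA.
  have lin u (x y : bop H) : setT x -> setT y ->
      k ** adj k ** (u *: x + y) = u *: (k ** adj k ** x) + k ** adj k ** y.
    by move=> _ _; exact: cmulDZr.
  have bd (x : bop H) : setT x ->
      rnorm (k ** adj k ** x) <= rnorm (k ** adj k) * rnorm x.
    by move=> _; exact: rnorm_cmul.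
  move=> y Ky.
  have [] // : [set x | setT x /\ span3 (range pi) X (range pi) (k ** adj k ** x)] y.
  apply: closed_span_min Ky.
  - exact: subspace_preimage.
  - by apply: closed_preimage lin bd _ _ _ => //; exact: closedT.
  move=> _ [_ [_ [_ [[c' _ <-] [b ->] [d' _ <-] ->]]]]; split=> //.
  rewrite kJ.
  have := gen c (L (d ** adj d) ** L (adj c ** c') ** b) d'.
  by rewrite !piM -[pi (L (adj c ** c'))]SpiS piM !cmulA.
move: wX => [b ->]; apply: subset_closed_span.
exists (pi (c ** alpha b)), (S ** adj S), (pi d); split=> //.
by rewrite Spi piM !cmulA.
Qed.

Lemma L_rep_redundancy : exel_redundancy pi S = L_redundancy pi S.
Proof.
apply/funext => a; apply/funext => k.
by rewrite /exel_redundancy /L_redundancy L_rep_span3.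
Qed.
End LRepresentations.

(** * Automatic continuity of *-homomorphisms *)

Section StarHomBounded.
Variables (R : realType) (A : cstarAlgType R).
Implicit Types (p r s x h : A).

(** Fixed points satisfy (1 - r)^2 = 1 - p, written without a unit. For |p| <= 1/2 the ball of
    radius 1/2 is preserved and contracted by 1/2. *)
Let Phi p r := (2^-1)%:C *: (p + r ** r).

Let rnorm_half_scale x : rnorm ((2^-1)%:C *: x) = 2^-1 * rnorm x.
Proof. by rewrite rnormZ rnorm_real// invr_ge0. Qed.

Let sqrB r s : r ** r - s ** s = r ** (r - s) + (r - s) ** s.
Proof. by rewrite cmulBr cmulBl addrA subrK. Qed.

Let Phi_contr p r s : rnorm r <= 2^-1 -> rnorm s <= 2^-1 ->
  rnorm (Phi p r - Phi p s) <= 2^-1 * rnorm (r - s).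
Proof.
move=> r1 s1; rewrite -scalerBr opprD addrACA subrr add0r rnorm_half_scale sqrB.
rewrite ler_pM2l ?invr_gt0//; apply: le_trans (rnormD _ _) _.
have := le_trans (rnorm_cmul r (r - s)) (ler_wpM2r (rnorm_ge0 _) r1).
have := le_trans (rnorm_cmul (r - s) s) (ler_wpM2l (rnorm_ge0 _) s1).
lra.
Qed.

Let Phi_half p r : rnorm p <= 2^-1 -> rnorm r <= 2^-1 -> rnorm (Phi p r) <= 2^-1.
Proof.
move=> p1 r1; rewrite rnorm_half_scale.
have h := rnormD p (r ** r); have := rnorm_cmul r r; have := rnorm_ge0 r.
by move: h p1 r1; nra.
Qed.

(* [1 - r] is a square root of [1 - p]. *)
Lemma quasi_sqrt_exists (T : set A) p : subspace T -> closed T ->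
  (forall x y, T x -> T y -> T (x ** y)) -> T p -> rnorm p <= 2^-1 ->
  exists r, [/\ T r, rnorm r <= 2^-1 & r + r = p + r ** r].
Proof.
move=> Ts Tc TM Tp p1; pose u n := iter n (Phi p) 0.
have uT n : T (u n).
  elim: n => [|n IH]; first exact: Ts.1.
  by apply: subspaceZ => //; apply: subspaceD => //; exact: TM.
have u1 n : rnorm (u n) <= 2^-1.
  elim: n => [|n IH]; first by rewrite /u/= rnorm0 invr_ge0.
  exact: Phi_half.
have uD n m : rnorm (u (n + m)%N - u n) <= 2^-1 ^+ n.
  elim: n => [|n IH].
    by rewrite add0n subr0 expr0 (le_trans (u1 m))// invf_le1// ler1n.
  rewrite addSn exprS -[u n.+1]/(Phi p (u n)) -[u (n + m).+1]/(Phi p (u (n + m)%N)).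
  apply: le_trans (Phi_contr p (u1 (n + m)%N) (u1 n)) _.
  by rewrite ler_pM2l// invr_gt0.
have small (e : R) : 0 < e -> exists n, 2^-1 ^+ n < e.
  move=> e0; exists (Num.bound e^-1).
  have := @archi_boundP R e^-1.
  rewrite invr_ge0 (ltW e0) => /(_ isT).
  set n := Num.bound _ => ne.
  rewrite exprVn invf_plt ?posrE ?exprn_gt0//.
  by apply: lt_le_trans ne _; rewrite -natrX ler_nat ltnW// ltn_expl.
have /cauchy_cvg uc : cauchy (u @ \oo).
  apply/cauchy_exP => e e0.
  have er : e = (complex.Re e)%:C by rewrite RRe_real// gtr0_real.
  have /small[n nE] : 0 < complex.Re e by rewrite -ltcR -er.
  exists (u n); exists n => // m /= nm.
  rewrite -ball_normE/= er rnormE ltcR rdistC -(subnKC nm).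
  exact: le_lt_trans (uD _ _) nE.
set r := lim (u @ \oo) in uc.
have ur (e : R) : 0 < e -> exists N, forall n, (N <= n)%N -> rnorm (r - u n) < e.
  move=> e0; have /uc[N _ h] : nbhs r (ball r e%:C).
    by apply: nbhsx_ballx; rewrite ltcR.
  by exists N => n /h /=; rewrite -ball_normE/= rnormE ltcR.
have rT : T r.
  apply: (closed_rnormP T).1 Tc _ _ => e /ur[N h]; exists (u N).
  by split=> //; exact: h.
have r1 : rnorm r <= 2^-1.
  apply/ler_addgt0Pr => e /ur[N /(_ _ (leqnn N)) h].
  rewrite -[r](subrK (u N)) addrC (le_trans (rnormD _ _))//.
  by rewrite lerD ?(ltW h).
exists r; split=> //; apply/eqP; rewrite -subr_eq0; apply/eqP.
have -> : r + r - (p + r ** r) = 2 *: (r - Phi p r).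
  rewrite scalerBr scalerA -(rmorph_nat (real_complex R)) -rmorphM/=.
  by rewrite divff ?pnatr_eq0// scale1r rmorph_nat scaler_nat mulr2n.
suff -> : r - Phi p r = 0 by rewrite scaler0.
(* Passing through u_{N+1} = Phi p u_N costs at most e plus e / 2, whence the constant 2. *)
apply: (@rnorm_le_eps_eq0 _ _ _ 2) => e e0; have [N h] := ur _ e0.
have h1 := h _ (leqnn N); have h2 := h _ (leqnSn N).
have h3 := Phi_contr p (u1 N) r1; rewrite -/(u N.+1) in h3.
rewrite (rdistC (u N)) in h3.
have -> : r - Phi p r = (r - u N.+1) + (Phi p (u N) - Phi p r).
  by rewrite addrA subrK.
apply: le_trans (rnormD _ _) _; move: e0 h1 h2 h3; lra.
Qed.

(** A contraction has at most one fixed point; this makes r self-adjoint when p is. *)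
Lemma quasi_sqrt_uniq p r s : rnorm r <= 2^-1 -> rnorm s <= 2^-1 ->
  r + r = p + r ** r -> s + s = p + s ** s -> r = s.
Proof.
move=> r1 s1 rE sE.
have fix_ q : q + q = p + q ** q -> q = Phi p q.
  move=> qE; rewrite /Phi -qE -mulr2n -[q *+ 2]scaler_nat scalerA.
  by rewrite -(rmorph_nat (real_complex R)) -rmorphM/= mulVf ?pnatr_eq0// scale1r.
have h := Phi_contr p r1 s1; rewrite -(fix_ _ rE) -(fix_ _ sE) in h.
apply/eqP; rewrite -subr_eq0; apply/eqP/rnorm_eq0/eqP.
rewrite eq_le rnorm_ge0 andbT; move: h; lra.
Qed.

(** The commutator d = h r - r h satisfies 2 d = d r + r d, so 2 |d| <= |d|. *)
Lemma quasi_sqrt_comm p r h : rnorm r <= 2^-1 -> r + r = p + r ** r ->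
  h ** p = p ** h -> h ** r = r ** h.
Proof.
move=> r1 rE hp; apply/eqP; rewrite -subr_eq0; apply/eqP.
set d := h ** r - r ** h.
have dE : d + d = d ** r + r ** d.
  rewrite /d addrACA -opprD -cmulDr -cmulDl rE cmulDr cmulDl hp.
  by rewrite opprD addrACA subrr add0r cmulBl cmulBr !cmulA addrA subrK.
apply/rnorm_eq0/eqP; rewrite eq_le rnorm_ge0 andbT.
have : 2 * rnorm d <= 2^-1 * rnorm d + rnorm d * 2^-1.
  have -> : 2 * rnorm d = rnorm (d + d).
    rewrite -mulr2n -[d *+ 2]scaler_nat rnormZ -(rmorph_nat (real_complex R)).
    by rewrite rnorm_real.
  rewrite dE addrC; apply: le_trans (rnormD _ _) _; rewrite lerD//.
    by apply: le_trans (rnorm_cmul _ _) _; rewrite ler_wpM2r ?rnorm_ge0.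
  by apply: le_trans (rnorm_cmul _ _) _; rewrite ler_wpM2l ?rnorm_ge0.
have := rnorm_ge0 d; lra.
Qed.

(* [h + i (1 - r)] is a unitary of the unitization of [A], and [h] is the mean
   of it and its adjoint. *)
Lemma rnorm_le1_unitary h r : adj h = h -> adj r = r -> h ** r = r ** h ->
  r + r = h ** h + r ** r -> rnorm h <= 1.
Proof.
move=> hJ rJ hr rE.
(* For c = i or -i, h + c (1 - r) acts isometrically: the cross terms cancel because a^* b = b^* a,
   and what remains is x^* (h^2 + (1 - r)^2) x = x^* x. *)
have iso c x : c^* * c = 1 -> c^* = - c ->
    rnorm (h ** x + c *: (x - r ** x)) = rnorm x.
  move=> cc cJ; apply/eqP.
  rewrite -(@eqrXn2 _ 2) ?rnorm_ge0// -!rnorm_adjM; apply/eqP; congr rnorm.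
  set a := h ** x; set b := x - r ** x.
  have ab : adj a ** b = adj b ** a.
    rewrite /a /b adjB !adjM hJ rJ cmulBr cmulBl -!cmulA.
    by rewrite [h ** (r ** x)]cmulA [r ** (h ** x)]cmulA hr.
  rewrite adjD adjZ cmulDl !cmulDr !cmulZl !cmulZr scalerA cc scale1r cJ scaleNr ab.
  rewrite addrA addrK.
  set P := adj x ** (r ** x); set Q := adj x ** (r ** (r ** x)).
  have -> : adj a ** a = P + (P - Q).
    rewrite addrA; apply/eqP; rewrite eq_sym subr_eq eq_sym; apply/eqP.
    have -> : adj a ** a = adj x ** (h ** h ** x) by rewrite /a adjM hJ !cmulA.
    have -> : Q = adj x ** (r ** r ** x) by rewrite /Q !cmulA.
    by rewrite /P -2!cmulDr -2!cmulDl rE.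
  have -> : adj b ** b = adj x ** x - (P + (P - Q)).
    rewrite adjB adjM rJ cmulBl !cmulBr -!cmulA -/P -/Q.
    by rewrite [in RHS]opprD addrA.
  by rewrite addrC subrK.
have ii : 'i^* * 'i = 1 :> R[i] by rewrite conjCi mulNr -expr2 sqrCi opprK.
have hx x : rnorm (h ** x) <= rnorm x.
  have h1 := iso 'i x ii (conjCi _).
  have h2 : rnorm (h ** x - 'i *: (x - r ** x)) = rnorm x.
    by rewrite -scaleNr iso// rmorphN ?mulrNN//= conjCi.
  have := rnormD (h ** x + 'i *: (x - r ** x)) (h ** x - 'i *: (x - r ** x)).
  rewrite h1 h2 addrACA subrr addr0 -mulr2n -[_ *+ 2]scaler_nat rnormZ.
  by rewrite -(rmorph_nat (real_complex R)) rnorm_real//; lra.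
(* For x = h the bound reads |h|^2 <= |h|. *)
have := hx h; have := rnorm_adjM h; rewrite hJ => -> hh.
rewrite leNgt; apply/negP => h1.
move: hh; apply/negP; rewrite -ltNge expr2 ltr_pMl//.
exact: lt_trans h1.
Qed.
End StarHomBounded.

(** The element h = x^* x / (2 |x^* x|) has norm at most 1/2, so it has a companion r in T. Their
    relations are algebraic, hence pass to f(h) and f(r) and force |f(h)| <= 1. The factor 2 is the
    one in h. *)
Lemma star_hom_on_bounded (R : realType) (A B : cstarAlgType R) (T : set A)
    (f : A -> B) : cstar_subalgebra T -> star_hom_on T f ->
  forall x, T x -> rnorm (f x) <= 2 * rnorm x.
Proof.
move=> [Ts Tc TM TJ] [fDZ fM fJ] x Tx.
have fD a b : T a -> T b -> f (a + b) = f a + f b.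
  by move=> Ta Tb; rewrite -[a]scale1r fDZ// !scale1r.
have f0 : f 0 = 0.
  by apply: (addrI (f 0)); rewrite -fD ?addr0//; exact: Ts.1.
have fZ c a : T a -> f (c *: a) = c *: f a.
  by move=> Ta; rewrite -[c *: a]addr0 fDZ ?f0 ?addr0//; exact: Ts.1.
set y := adj x ** x; have Ty : T y by apply: TM => //; exact: TJ.
have fy : rnorm (f y) <= 2 * rnorm y.
  have [y0|y0] := eqVneq (rnorm y) 0.
    by rewrite (rnorm_eq0 y0) f0 !rnorm0 mulr0.
  have ygt0 : 0 < 2 * rnorm y.
    by rewrite mulr_gt0// lt_neqAle eq_sym y0 rnorm_ge0.
  pose c := (2 * rnorm y)^-1; have c0 : 0 <= c by rewrite invr_ge0 ltW.
  pose h := c%:C *: y; have Th : T h by exact: subspaceZ.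
  have hJ : adj h = h.
    rewrite adjZ /y adjM adjK; congr (_ *: _).
    exact: conjc_real.
  have h1 : rnorm h <= 2^-1.
    by rewrite rnormZ rnorm_real// /c invfM -mulrA mulVf// mulr1.
  have hh1 : rnorm (h ** h) <= 2^-1.
    by have := rnorm_cmul h h; have := rnorm_ge0 h; move: h1; nra.
  have [r [Tr r1 rE]] := quasi_sqrt_exists Ts Tc TM (TM _ _ Th Th) hh1.
  have rJ : adj r = r.
    apply: (@quasi_sqrt_uniq _ _ (h ** h)); rewrite ?rnorm_adj//.
    by rewrite -adjD rE adjD !adjM hJ.
  have hr : h ** r = r ** h by apply: (quasi_sqrt_comm r1 rE); rewrite cmulA.
  have : rnorm (f h) <= 1.
    apply: (@rnorm_le1_unitary _ _ _ (f r)); rewrite -?fJ ?hJ ?rJ//.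
      by rewrite -!fM// hr.
    by rewrite -!fM// -!fD ?rE//; exact: TM.
  by rewrite fZ// rnormZ rnorm_real// /c mulrC ler_pdivrMr// mul1r.
rewrite -(@ler_pXn2r _ 2) ?nnegrE ?mulr_ge0 ?rnorm_ge0// -rnorm_adjM -fJ//.
rewrite -fM//; last exact: TJ.
apply: le_trans fy _; rewrite /y rnorm_adjM exprMn.
by rewrite ler_wpM2r ?sqr_ge0// expr2 ler_peMr// ler1n.
Qed.

(** * Generated C*-subalgebras and ideals *)

Section Generated.
Variables (R : realType) (A : cstarAlgType R).
Implicit Types (T X : set A).

Lemma subset_cstar_generated X : X `<=` cstar_generated X.
Proof. by move=> x Xx T [_]; exact. Qed.

Lemma cstar_subalgebra_generated X : cstar_subalgebra (cstar_generated X).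
Proof.
split.
- split=> [T [[[]]]//|c x y Tx Ty T TX].
  by have [[Ts _ _ _] _] := TX; apply: Ts.2; [exact: Tx | exact: Ty].
- apply/closed_rnormP => x h T TX; have [[_ Tc _ _] _] := TX.
  apply: (closed_rnormP T).1 Tc _ _ => e /h[y [Xy xy]].
  by exists y; split=> //; exact: Xy.
- move=> x y Tx Ty T TX.
  by have [[_ _ TM _] _] := TX; apply: TM; [exact: Tx | exact: Ty].
- by move=> x Tx T TX; have [[_ _ _ TJ] _] := TX; apply: TJ; exact: Tx.
Qed.

Variable B : cstarAlgType R.
Implicit Types f g : A -> B.

Lemma star_hom_on_generated X f (T' : set B) :
  star_hom_on (cstar_generated X) f -> cstar_subalgebra T' ->
  (forall x, X x -> T' (f x)) -> forall x, cstar_generated X x -> T' (f x).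
Proof.
move=> fh T'a fX x; have Ta := cstar_subalgebra_generated X.
have bd := star_hom_on_bounded Ta fh.
have [Ts Tc TM TJ] := Ta; have [fDZ fM fJ] := fh.
have [T's T'c T'M T'J] := T'a.
suff sub : cstar_subalgebra [set x | cstar_generated X x /\ T' (f x)].
  move=> Xx; have [] // : [set x | cstar_generated X x /\ T' (f x)] x.
  apply: Xx; split=> // y Xy; split; last exact: fX.
  exact: subset_cstar_generated.
split.
- exact: subspace_preimage.
- exact: closed_preimage bd _ _ _.
- by move=> a b [Ta1 Ma] [Tb Mb]; split; [exact: TM | rewrite fM//; exact: T'M].
- by move=> a [Ta1 Ma]; split; [exact: TJ | rewrite fJ//; exact: T'J].
Qed.

(** The equalizer is the zero set of f - g, which is bounded with constant 2 + 2; so it is a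
    C*-subalgebra. *)
Lemma star_hom_on_eq_generated X f g :
  star_hom_on (cstar_generated X) f -> star_hom_on (cstar_generated X) g ->
  (forall x, X x -> f x = g x) -> forall x, cstar_generated X x -> f x = g x.
Proof.
move=> fh gh fg x; have Ta := cstar_subalgebra_generated X.
have fb := star_hom_on_bounded Ta fh; have gb := star_hom_on_bounded Ta gh.
have [Ts Tc TM TJ] := Ta.
have [fDZ fM fJ] := fh; have [gDZ gM gJ] := gh.
pose d x := f x - g x.
have dDZ c a b : cstar_generated X a -> cstar_generated X b ->
    d (c *: a + b) = c *: d a + d b.
  by move=> Xa Xb; rewrite /d fDZ// gDZ// scalerBr opprD addrACA.
have db a : cstar_generated X a -> rnorm (d a) <= 4 * rnorm a.
  move=> Xa; apply: le_trans (rnormD _ _) _; rewrite rnormN.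
  by have := fb _ Xa; have := gb _ Xa; lra.
suff sub : cstar_subalgebra [set x | cstar_generated X x /\ [set 0] (d x)].
  move=> Xx; have [_ /= /subr0_eq//] :
    [set x | cstar_generated X x /\ [set 0] (d x)] x.
  apply: Xx; split=> // y Xy; split; first exact: subset_cstar_generated.
  by rewrite /d/= fg// subrr.
split.
- by apply: subspace_preimage => //; exact: subspace_zero.
- by apply: closed_preimage dDZ db _ _ _ => //; exact: closed_zero.
- move=> a b [Xa /= /subr0_eq ab] [Xb /= /subr0_eq bb]; split; first exact: TM.
  by rewrite /d/= fM// gM// ab bb subrr.
- move=> a [Xa /= /subr0_eq ab]; split; first exact: TJ.
  by rewrite /d/= fJ// gJ// ab subrr.
Qed.

Lemma ideal_generated_ker T X f : cstar_subalgebra T -> star_hom_on T f ->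
  X `<=` T -> (forall x, X x -> f x = 0) ->
  forall x, ideal_generated T X x -> f x = 0.
Proof.
move=> Ta fh XT X0 x; have fb := star_hom_on_bounded Ta fh.
have [Ts Tc TM _] := Ta; have [fDZ fM _] := fh.
suff sub : closed_ideal T [set x | T x /\ [set 0] (f x)].
  move=> Xx; have [] // : [set x | T x /\ [set 0] (f x)] x.
  by apply: Xx; split=> // y Xy; split; [exact: XT | exact: X0].
split.
- by move=> y [].
- by apply: subspace_preimage => //; exact: subspace_zero.
- by apply: closed_preimage fDZ fb _ _ _ => //; exact: closed_zero.
- move=> a y Ta1 [Ty /= fy]; do 2?split; rewrite /= ?fM// ?fy ?cmul0r ?cmul0l//.
    exact: TM.
  exact: TM.
Qed.
End Generated.

(** * Uniqueness of crossed products *)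

Section CrossedProductUniqueness.
Variables (R : realType) (A : cstarAlgType R).

Section RepAlgebra.
Variables (H : hilbertType R) (pi : A -> bop H) (S : bop H).
Hypothesis pi_hom : star_hom pi.
Let T := rep_algebra pi S.

Lemma cstar_subalgebra_rep : cstar_subalgebra T.
Proof. exact: cstar_subalgebra_generated. Qed.

Lemma rep_algebra_pi a : T (pi a).
Proof. by apply: subset_cstar_generated; left; exists a. Qed.

Lemma rep_algebra_piS a : T (pi a ** S).
Proof. by apply: subset_cstar_generated; right; exists a. Qed.

Section Transport.
Variables (K : hilbertType R) (pi' : A -> bop K) (S' : bop K).
Variable f : bop H -> bop K.
Hypothesis f_hom : star_hom_on T f.
Hypothesis f_pi : forall a, f (pi a) = pi' a.
Hypothesis f_piS : forall a, f (pi a ** S) = pi' a ** S'.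

Lemma rep_map_algebra x : T x -> rep_algebra pi' S' (f x).
Proof.
move=> Tx; have h := star_hom_on_generated f_hom _ _ Tx.
apply: h; first exact: cstar_subalgebra_generated.
move=> _ [[a _ <-]|[a ->]]; apply: subset_cstar_generated.
  by rewrite f_pi; left; exists a.
by rewrite f_piS; right; exists a.
Qed.

(** Boundedness of f carries the closed span over, and S enters only through the elements
    [pi a ** S] of T. *)
Lemma redundancy_map a k : L_redundancy pi S a k ->
  T k /\ L_redundancy pi' S' a (f k).
Proof.
move=> [Kk kS]; have Ta := cstar_subalgebra_rep.
have fb := star_hom_on_bounded Ta f_hom.
have [Ts Tc TM TJ] := Ta; have [fDZ fM fJ] := f_hom.
have [_ piM piJ] := pi_hom.
pose X' : set (bop K) := [set w | exists b, w = S' ** pi' b ** adj S'].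
have sub : [set x | T x /\ span3 (range pi') X' (range pi') (f x)] k.
  apply: Kk; split; first split.
  - by apply: subspace_preimage => //; exact: subspace_closed_span.
  - by apply: closed_preimage fDZ fb _ _ _ => //; exact: closed_closed_span.
  move=> _ [_ [_ [_ [[b _ <-] [c ->] [d _ <-] ->]]]].
  (* S alone need not lie in T, so the last two factors are regrouped into the adjoint of an element
     of T. *)
  have -> : pi b ** (S ** pi c ** adj S) ** pi d =
      pi b ** S ** pi c ** adj (pi (adj d) ** S).
    by rewrite adjM -piJ// adjK !cmulA.
  have Tb := rep_algebra_piS b; have Td := rep_algebra_piS (adj d).
  have Tpc := rep_algebra_pi c.
  split; first exact: (TM _ _ (TM _ _ Tb Tpc) (TJ _ Td)).
  rewrite (fM _ _ (TM _ _ Tb Tpc) (TJ _ Td)) fM// fJ//.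
  apply: subset_closed_span; exists (pi' b), (S' ** pi' c ** adj S'), (pi' d).
  split=> //; first by exists c.
  have piJ' : adj (pi' (adj d)) = pi' d.
    by rewrite -f_pi -fJ ?piJ ?adjK ?f_pi// -piJ//; exact: rep_algebra_pi.
  by rewrite f_piS f_pi f_piS adjM piJ' !cmulA.
have [Tk fk] := sub; split=> //; split=> // b.
rewrite -!cmulA -f_piS -f_pi -!fM//; try exact: rep_algebra_pi.
- by rewrite !cmulA kS.
- exact: rep_algebra_piS.
- exact: rep_algebra_piS.
Qed.
End Transport.
End RepAlgebra.

(** Universality gives f between the algebras of the two representations. It preserves redundancies,
    so q' o f kills the kernel of q and descends to B. *)
Lemma crossed_product_map (rep : forall H, (A -> bop H) -> bop H -> Prop)
    (J : set A) (B C : cstarAlgType R) (i u : A -> B) (j v : A -> C) :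
  (forall H (pi : A -> bop H) S, rep H pi S -> star_hom pi) ->
  crossed_product_of rep (@L_redundancy R A) J i u ->
  crossed_product_of rep (@L_redundancy R A) J j v ->
  exists Phi : B -> C, [/\ star_hom Phi,
    forall a, Phi (i a) = j a & forall a, Phi (u a) = v a].
Proof.
move=> rep_hom [H [iA [t [q [[hrep univ] [q_hom q_surj q_ker] iE uE]]]]].
move=> [H' [iA' [t' [q' [[hrep' _] [q'_hom _ q'_ker] jE vE]]]]].
have [f [f_hom f_i f_t]] := univ _ _ _ hrep'.
pose T := rep_algebra iA t; pose T' := rep_algebra iA' t'.
have fT x : T x -> T' (f x) by exact: rep_map_algebra.
have [Ts _ TM TJ] : cstar_subalgebra T := cstar_subalgebra_rep iA t.
have [fDZ fM fJ] := f_hom; have [qDZ qM qJ] := q_hom.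
have [q'DZ q'M q'J] := q'_hom.
have F_hom : star_hom_on T (q' \o f).
  split=> [c x y Tx Ty|x y Tx Ty|x Tx] /=.
  - by rewrite fDZ// q'DZ//; exact: fT.
  - by rewrite fM// q'M//; exact: fT.
  - by rewrite fJ// q'J//; exact: fT.
have F_ker x : T x -> q x = 0 -> q' (f x) = 0.
  move=> Tx /(q_ker x Tx).
  apply: (ideal_generated_ker (cstar_subalgebra_rep iA t) F_hom).
    move=> _ [a [k [_ ak ->]]].
    have [Tk _] := redundancy_map (rep_hom _ _ _ hrep) f_hom f_i f_t ak.
    by apply: (subspaceB Ts); [exact: rep_algebra_pi | exact: Tk].
  move=> _ [a [k [Ja ak ->]]] /=.
  have [Tk ak'] := redundancy_map (rep_hom _ _ _ hrep) f_hom f_i f_t ak.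
  have Ti : T (iA a) by exact: rep_algebra_pi.
  have -> : f (iA a - k) = iA' a - f k.
    by rewrite addrC -scaleN1r fDZ// scaleN1r f_i addrC.
  apply/q'_ker; last by move=> I' [_]; apply; exists a, (f k).
  have [T's _ _ _] := cstar_subalgebra_rep iA' t'.
  by apply: (subspaceB T's); [exact: rep_algebra_pi | exact: fT].
have sect b : exists x, T x /\ q x = b.
  have : [set: B] b by [].
  by rewrite -q_surj => -[x Tx <-]; exists x.
(* A set-theoretic section of q; [q_eq] makes the value of q' o f independent of the choice. *)
pose s b := sval (cid (sect b)).
have sT b : T (s b) := (svalP (cid (sect b))).1.
have qs b : q (s b) = b := (svalP (cid (sect b))).2.
have q_eq x y : T x -> T y -> q x = q y -> q' (f x) = q' (f y).
  move=> Tx Ty xy; apply/eqP; rewrite -subr_eq0; apply/eqP.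
  have e (z z' : bop H) : z - z' = (-1) *: z' + z by rewrite scaleN1r addrC.
  have [FDZ _ _] := F_hom.
  have := F_ker (x - y) (subspaceB Ts Tx Ty).
  rewrite e qDZ// xy scaleN1r addNr => /(_ erefl).
  by rewrite -[q' _]/((q' \o f) _) FDZ// scaleN1r addrC.
have [FDZ FM FJ] := F_hom.
exists (fun b => q' (f (s b))); split.
- split=> [c x y _ _|x y _ _|x _].
  + rewrite -[RHS]FDZ//; apply: q_eq => //; first exact: Ts.2.
    by rewrite qDZ ?qs//; exact: sT.
  + rewrite -[RHS]FM//; apply: q_eq => //; first exact: TM.
    by rewrite qM ?qs//; exact: sT.
  + rewrite -[RHS]FJ//; apply: q_eq => //; first exact: TJ.
    by rewrite qJ ?qs//; exact: sT.
- move=> a; have Ti : T (iA a) by exact: rep_algebra_pi.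
  by rewrite jE -f_i; apply: q_eq => //; rewrite qs iE.
- move=> a; have Ti : T (iA a ** t) by exact: rep_algebra_piS.
  by rewrite vE -f_t; apply: q_eq => //; rewrite qs uE.
Qed.

(** Phi o q and q agree on generators, and q is onto. *)
Lemma crossed_product_endo (rep : forall H, (A -> bop H) -> bop H -> Prop)
    redundancy (J : set A) (B : cstarAlgType R) (i u : A -> B) (Phi : B -> B) :
  crossed_product_of rep redundancy J i u -> star_hom Phi ->
  (forall a, Phi (i a) = i a) -> (forall a, Phi (u a) = u a) -> Phi =1 id.
Proof.
move=> [H [iA [t [q [_ [q_hom q_surj _] iE uE]]]]] Phi_hom Phii Phiu b.
have [PDZ PM PJ] := Phi_hom; have [qDZ qM qJ] := q_hom.
have : [set: B] b by [].
rewrite -q_surj => -[x Tx <-].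
apply: (@star_hom_on_eq_generated _ _ _ _ (Phi \o q) q _ q_hom _ _ Tx).
  split=> [c y z Ty Tz|y z Ty Tz|y Ty] /=.
  - by rewrite qDZ// PDZ.
  - by rewrite qM// PM.
  - by rewrite qJ// PJ.
by move=> _ [[a _ <-]|[a ->]] /=; rewrite -?iE -?uE.
Qed.

Lemma crossed_product_uniq (rep : forall H, (A -> bop H) -> bop H -> Prop)
    (J : set A) :
  (forall H (pi : A -> bop H) S, rep H pi S -> star_hom pi) ->
  same_universal_algebra (crossed_product_of rep (@L_redundancy R A) J)
    (crossed_product_of rep (@L_redundancy R A) J).
Proof.
move=> rep_hom B C i u j v Bi Cj.
have [Phi [Phi_hom Phi_i Phi_u]] := crossed_product_map rep_hom Bi Cj.
have [Psi [Psi_hom Psi_j Psi_v]] := crossed_product_map rep_hom Cj Bi.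
have comp (D E F : cstarAlgType R) (f : D -> E) (g : E -> F) :
    star_hom f -> star_hom g -> star_hom (g \o f).
  move=> [fDZ fM fJ] [gDZ gM gJ].
  by split=> *; rewrite /= ?fDZ ?fM ?fJ// ?gDZ ?gM ?gJ.
exists Phi; split=> //; exists Psi.
  apply: (crossed_product_endo Bi (comp _ _ _ _ _ Phi_hom Psi_hom)) => a /=.
    by rewrite Phi_i Psi_j.
  by rewrite Phi_u Psi_v.
apply: (crossed_product_endo Cj (comp _ _ _ _ _ Psi_hom Phi_hom)) => a /=.
  by rewrite Psi_j Phi_i.
by rewrite Psi_v Phi_u.
Qed.
End CrossedProductUniqueness.

(** * Comparison of Exel's crossed product with the relative one *)

Lemma exel_crossed_product_relative (R : realType) (A : cstarAlgType R)
    (alpha L : A -> A) : exel_system alpha L ->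
  same_universal_algebra (exel_crossed_product alpha L)
    (relative_crossed_product L (span3 setT (range alpha) setT)).
Proof.
move=> hexel B C i u j v Bi; apply: crossed_product_uniq.
  by move=> H pi S [[]].
(* It remains to see that (B, i, u) is itself a relative crossed product, realized by the same iA, t
   and q. *)
have repE H (pi : A -> bop H) S : exel_rep alpha L pi S <-> L_rep L pi S.
  split=> [[nd _ SpiS]|]; first by split.
  exact: L_rep_exel_rep.
have [H [iA [t [q [[hrep univ] q_quot iE uE]]]]] := Bi.
have hL := (repE _ _ _).1 hrep.
exists H, iA, t, q; split=> //.
  by split=> // K pi S /repE; exact: univ.
by rewrite -(L_rep_redundancy hexel hL).
Qed.

Theorem proposition4p18 (R : realType) (A : cstarAlgType R) (alpha L : A -> A)
    (hreg : regular_exel_system alpha L)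
    (hfaithful : faithful_on L (span3 setT (range alpha) setT)) :
  [/\ range alpha = annihilator (MD L) (ker_MD L),
      forall alpha' : A -> A, regular_exel_system alpha' L ->
        faithful_on L (span3 setT (range alpha') setT) -> alpha' = alpha,
      same_universal_algebra (exel_crossed_product alpha L)
        (relative_crossed_product L
          (span3 setT (annihilator (MD L) (ker_MD L)) setT))
    & span3 setT (annihilator (MD L) (ker_MD L)) setT =
        annihilator setT (NL L) ->
      same_universal_algebra (exel_crossed_product alpha L)
        (crossed_product_by L)].
Proof.
have rE := regular_range hreg hfaithful.
have same := exel_crossed_product_relative hreg.1.
rewrite -rE; split=> // [alpha' hreg' hfaithful'|JE].
  (* Both ranges equal the same annihilator, which depends on L alone. *)
  apply: (regular_alpha_uniq hreg hreg').
  by rewrite (regular_range hreg' hfaithful').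
by rewrite /crossed_product_by -JE.
Qed.
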